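(* There is a universal constant $c<2\cdot 10^{8}$ such that, if $n=\Omega(\log m)$, then $$\beta^{m,n}_\infty\le c\cdot \log m .$$ Furthermore, if $n=\Omega(\log m)$, then $\beta^{m,n}_\infty=\Omega\big(\sqrt{\log m/\log\log m}\big)$.
   Context: Model. An unknown vector $x\in X\subseteq\mathbb{R}^n$ is observed through $y=x+w$ with $w\sim \mathsf{N}(0,\sigma^2 I)$ Gaussian in $\mathbb{R}^n$, $\sigma>0$; $\|\cdot\|$ is the Euclidean norm and $\mathbb{E}$ is expectation over $w$. Minimax risk: $R(X,\sigma)=\inf_{M}\sup_{x\in X}\mathbb{E}\|x-M(y)\|^2$, the infimum over all (possibly nonlinear, measurable) estimators $M:\mathbb{R}^n\to\mathbb{R}^n$. Truncated series risk: $R_T(X,\sigma)=\min_{P}\sup_{x\in X}\mathbb{E}\|x-Py\|^2$, the minimum over all orthogonal projections $P$ of $\mathbb{R}^n$ onto linear subspaces (of any dimension $0,\dots,n$). For $p\in[1,\infty]$, $\mathcal{F}^{m,n}_p$ is the family of all bounded sets of the form $X=\{x\in\mathbb{R}^n:\ \|Ax\|_p\le 1\}$ with $A\in\mathbb{R}^{m\times n}$. In particular $\mathcal{F}^{m,n}_\infty$ consists of bounded symmetric convex polytopes defined by $m$ hyperplanes. (Only bounded convex bodies are considered.) Define $\beta(X)=\sup_{\sigma>0}R_T(X,\sigma)/R(X,\sigma)$ and $\beta^{m,n}_p=\sup_{X\in\mathcal{F}^{m,n}_p}\beta(X)$. Here $\log$ is the natural logarithm and $m\ge 2$. The asymptotic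 notation is for $m\to\infty$: $n=\Omega(\log m)$ means $n\ge a\log m$ for some fixed constant $a>0$, and $\beta^{m,n}_\infty=\Omega(f(m))$ means $\beta^{m,n}_\infty\ge b\,f(m)$ for all sufficiently large $m$, with a constant $b>0$ (allowed to depend on $a$) not depending on $m,n$.
   Formalization: The lower bound is stated for n ≤ m − m^d, with d > 0 an arbitrary fixed exponent on which the constant b may depend; for n > m the family of bounded polytopes is empty and the claim fails. *)

(* Defs.v *)
From HB Require Import structures.
From mathcomp Require Import all_boot all_order all_algebra.
From mathcomp Require Import all_classical all_reals all_analysis.

Set Implicit Arguments.
Unset Strict Implicit.
Unset Printing Implicit Defensive.

Import Order.TTheory GRing.Theory Num.Theory.
Import numFieldNormedType.Exports.

Local Open Scope classical_set_scope.
Local Open Scope ring_scope.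

(* R^n is 'cV[R]_n, with the sigma-algebra generated by the coordinates
   (the Borel sigma-algebra). *)
Section measurable_cV.
Context (R : realType) (n : nat).

Let coord (i : 'I_n) (x : 'cV[R]_n) : measurableTypeR R := x i ord0.

Let cV_set0 : g_sigma_preimage coord set0.
Proof. exact: sigma_algebra0. Qed.

Let cV_setC A : g_sigma_preimage coord A -> g_sigma_preimage coord (~` A).
Proof. exact: sigma_algebraC. Qed.

Let cV_bigcup (F : _^nat) : (forall i, g_sigma_preimage coord (F i)) ->
  g_sigma_preimage coord (\bigcup_i (F i)).
Proof. exact: sigma_algebra_bigcup. Qed.

HB.instance Definition _ :=
  @isMeasurable.Build (measure_tuple_display default_measure_display)
    'cV[R]_n (g_sigma_preimage coord) cV_set0 cV_setC cV_bigcup.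

End measurable_cV.

Section gaussian.
Context (R : realType).

Definition cons_cV (n : nat) (p : measurableTypeR R * 'cV[R]_n) :
    'cV[R]_n.+1 :=
  \col_i (if unlift ord0 i is Some j then p.2 j ord0 else p.1 : R).

Lemma measurable_coord (n : nat) (i : 'I_n) :
  measurable_fun setT (fun x : 'cV[R]_n => x i ord0 : measurableTypeR R).
Proof.
move=> _ Y mY; rewrite setTI; apply: sub_sigma_algebra => /=.
rewrite -bigcup_seq/=; exists i => /=; first by rewrite mem_index_enum.
by exists Y => //; rewrite setTI.
Qed.

Lemma measurable_fun_cV d (T : measurableType d) (n : nat)
    (f : T -> 'cV[R]_n) :
  (forall i, measurable_fun setT (fun t => f t i ord0 : measurableTypeR R)) ->
  measurable_fun setT f.
Proof.
move=> mf _ Y; rewrite setTI; move: Y.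
suff : @measurable _ 'cV[R]_n `<=` [set Y | measurable (f @^-1` Y)] by [].
apply: smallest_sub.
  split => /=.
  - by rewrite preimage_set0.
  - move=> A mA; rewrite setTD preimage_setC; exact: measurableC.
  - by move=> F mF; rewrite preimage_bigcup; exact: bigcupT_measurable.
move=> A; rewrite -bigcup_seq => -[i _ [B mB <-]] /=.
by rewrite !setTI; have := mf i measurableT B mB; rewrite setTI.
Qed.

Lemma measurable_cons_cV (n : nat) : measurable_fun setT (@cons_cV n).
Proof.
apply: measurable_fun_cV => i; rewrite /cons_cV.
under eq_fun do rewrite mxE.
case: unliftP => [j _|_] /=; last exact: measurable_fst.
exact: (measurableT_comp (measurable_coord j) measurable_snd).
Qed.

HB.instance Definition _ (n : nat) :=
  isMeasurableFun.Build _ _ _ _ (@cons_cV n) (@measurable_cons_cV n).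

Section product_probability.
Context (n : nat) (P : probability (measurableTypeR R) R)
  (Q : probability 'cV[R]_n R).

Definition product_prob : set (measurableTypeR R * 'cV[R]_n) -> \bar R :=
  (P \x Q)%E.

HB.instance Definition _ := Measure.on product_prob.

Let product_prob_setT : product_prob setT = 1%E.
Proof.
rewrite -setXTT [LHS]product_measure1E//.
rewrite -[RHS]mule1; congr (_ * _)%E; exact: probability_setT.
Qed.

HB.instance Definition _ :=
  Measure_isProbability.Build _ _ _ product_prob product_prob_setT.

End product_probability.

(* N(0, s^2 I) on R^n: the n-fold product of normal_prob 0 s *)
Fixpoint gaussian (s : R) (n : nat) : probability 'cV[R]_n R :=
  if n is n'.+1 then
    distribution (product_prob (normal_prob 0 s) (gaussian s n')) (@cons_cV n')
  else dirac (0 : 'cV[R]_0).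

Lemma gaussian_box (s : R) (n : nat) (A : 'I_n -> set (measurableTypeR R)) :
  (forall i, measurable (A i)) ->
  gaussian s n [set w | forall i, A i (w i ord0)] =
  (\prod_(i < n) normal_prob 0 s (A i))%E.
Proof.
elim: n A => [|n IHn] A mA.
  rewrite big_ord0 /= diracE mem_set//; by case.
pose B : set 'cV[R]_n := [set w | forall i, A (lift ord0 i) (w i ord0)].
have mB : measurable B.
  rewrite (_ : B = \bigcap_(i in [set: 'I_n])
      ((fun w : 'cV[R]_n => w i ord0 : measurableTypeR R) @^-1`
        A (lift ord0 i))).
    apply: fin_bigcap_measurable => // i _.
    by have := measurable_coord i measurableT (mA (lift ord0 i)); rewrite setTI.
  by apply/seteqP; split => [w Bw i _|w Bw i]; [exact: Bw|exact: (Bw i)].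
rewrite big_ord_recl -(IHn (fun i => A (lift ord0 i)))//.
rewrite -[RHS](@product_measure1E _ _ _ _ _ (normal_prob 0 s) (gaussian s n))//.
rewrite /= /distribution /pushforward.
congr (product_measure1 _ _ _); apply/seteqP; split => -[z w] /=.
  move=> Azw; split => [|i].
    by have := Azw ord0; rewrite mxE unlift_none.
  by have := Azw (lift ord0 i); rewrite mxE liftK.
move=> [Az Bw] i; rewrite mxE; case: unliftP => [j ->|->] //=; exact: Bw.
Qed.

End gaussian.

Section risk.
Context (R : realType).

Definition enorm (n : nat) (x : 'cV[R]_n) : R :=
  Num.sqrt (\sum_(i < n) x i ord0 ^+ 2).

Definition mean_sq_err (n : nat) (s : R) (M : 'cV[R]_n -> 'cV[R]_n)
    (x : 'cV[R]_n) : \bar R :=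
  ('E_(gaussian s n)[fun w => (enorm (x - M (x + w)) ^+ 2)%R])%E.

Definition worst_risk (n : nat) (X : set 'cV[R]_n) (s : R)
    (M : 'cV[R]_n -> 'cV[R]_n) : \bar R :=
  ereal_sup [set mean_sq_err s M x | x in X].

Definition minimax_risk (n : nat) (X : set 'cV[R]_n) (s : R) : \bar R :=
  ereal_inf [set worst_risk X s M |
             M in [set M : 'cV[R]_n -> 'cV[R]_n | measurable_fun setT M]].

Definition orthogonal_projection (n : nat) (P : 'M[R]_n) : Prop :=
  P *m P = P /\ P^T = P.

Definition truncated_risk (n : nat) (X : set 'cV[R]_n) (s : R) : \bar R :=
  ereal_inf [set worst_risk X s (fun y => P *m y) |
             P in [set P : 'M[R]_n | orthogonal_projection P]].

Definition beta (n : nat) (X : set 'cV[R]_n) : \bar R :=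
  ereal_sup [set (truncated_risk X s / minimax_risk X s)%E |
             s in [set s : R | 0 < s]].

(* The canonical norm on matrices is the max-norm: `|A *m x| is the
   sup-norm of the vector A *m x. *)
Definition bounded_polytopes (m n : nat) : set (set 'cV[R]_n) :=
  [set X | bounded_set X /\
    exists A : 'M[R]_(m, n), X = [set x : 'cV[R]_n | `|A *m x| <= 1]].
Arguments bounded_polytopes : clear implicits.

(* This is -oo when no bounded polytope with m constraints exists in R^n,
   i.e. when m < n. *)
Definition beta_infty (m n : nat) : \bar R :=
  ereal_sup [set beta X | X in bounded_polytopes m n].

End risk.

(* Main.v *)
Require Import Defs.
From mathcomp Require Import all_boot all_order all_algebra.
From mathcomp Require Import all_classical all_reals all_analysis.
From mathcomp Require Import measurable_realfun spectral complex zify ring lra.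

(** Throughout, [s] is the noise level and a polytope is
    { x : |a_i x| <= 1 for all i }, where the a_i are the m rows of A.

    Upper bound.  Relax the polytope to the second moment matrices S >= 0 with
    a_i S a_i^T <= 1 for all i; it contains every x x^T with x in the polytope.
    Choose a feasible S, with eigenvectors u_j and eigenvalues v_j, that nearly
    maximises the concave function sum_j v_j / (v_j + s^2), which up to the
    factor s^2 is the Bayes risk of the prior N(0, S).  Moving from S a little
    towards x x^T cannot increase this function much, and the Sherman-Morrison
    formula turns this into a bound on sum_j <u_j, x>^2 / (v_j + s^2)^2 that is
    uniform over the polytope ([feasible_opt]).  Hence projecting on the u_j
    with v_j > s^2 has worst risk at most a constant times
    K = sum_j min (v_j, s^2) ([truncated_risk_le]).  Conversely, consider the
    hypercube with axes u_j and half sides sqrt (min (v_j, s^2) / L), where L is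
    a large multiple of log m.  Feasibility of S, Hoeffding's inequality and a
    union bound over the m rows show that three quarters of its vertices lie in
    the polytope, and Assouad's argument on those vertices bounds the minimax
    risk below by a constant times K / L ([minimax_risk_ge]).  The ratio of the
    risks is therefore at most a constant times L.

    Lower bound.  Take k proportional to log m and the unit ball of the l1 norm
    in the first k coordinates, which is cut out by 2^k sign vectors, times a
    tiny box in the other coordinates ([cross]).  At noise level s = 1 / sqrt k
    an orthogonal projection either has rank of order k, and pays for the noise,
    or is far from one of the first k basis vectors: the truncated series risk
    is bounded below by a constant ([cross_truncated_risk]).  Soft thresholding
    at s * sqrt (2 log k) has risk of order sqrt (log k / k)
    ([cross_minimax_risk]).

    The one fact used about the Gaussian measure is the Cameron-Martin formula
    ([gaussian_shift]), the density of a translated Gaussian; exponential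
    moments, bounds for second moments and the two point lower bound of
    Assouad's argument ([Egauss_two_point]) all follow from it. *)

Set Implicit Arguments.
Unset Strict Implicit.
Unset Printing Implicit Defensive.

Import Order.TTheory GRing.Theory Num.Theory.
Import numFieldNormedType.Exports.

Local Open Scope classical_set_scope.
Local Open Scope ring_scope.

(** * Translation of Gaussian measures *)

Section normal_shift.
Context (R : realType).
Local Open Scope ereal_scope.
Local Notation mu := (@lebesgue_measure R).
Local Notation RM := (measurableTypeR R).

Lemma integral_normal_prob (s : R) (h : RM -> \bar R) : s != 0%R ->
  measurable_fun setT h -> (forall x, 0 <= h x) ->
  \int[normal_prob 0 s]_x h x = \int[mu]_x (h x * (normal_pdf 0 s x)%:E).
Proof.
move=> s0 mh h0.
have dom : normal_prob 0 s `<< mu by exact: normal_prob_dominates.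
rewrite -(Radon_Nikodym_SigmaFinite.change_of_variables dom)//.
apply: ae_eq_integral => //.
- apply: emeasurable_funM => //; apply: (measurable_int mu).
  exact: Radon_Nikodym_SigmaFinite.f_integrable.
- apply: emeasurable_funM => //; apply/measurable_EFinP.
  exact: measurable_normal_pdf.
- apply: ae_eqe_mul2l; apply: integral_ae_eq => //.
  + exact: Radon_Nikodym_SigmaFinite.f_integrable.
  + by apply/measurable_EFinP; exact: measurable_normal_pdf.
  + by move=> E _ mE; rewrite -Radon_Nikodym_SigmaFinite.f_integral.
Qed.

Lemma lebesgue_measure_shift (v : R) (A : set RM) : measurable A ->
  pushforward mu ((fun x => x + v)%R : RM -> RM) A = mu A.
Proof.
move=> mA; apply/esym.
have mphi : measurable_fun setT ((fun x => x + v)%R : RM -> RM).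
  exact: measurable_funD.
apply: lebesgue_measure_unique => // _ [[a b]] _ <-.
rewrite [RHS](_ : _ = mu `](a - v)%R, (b - v)%R]%classic); last first.
  congr (mu _); apply/seteqP; split => x /=;
  by rewrite !in_itv/= ltrBlDr lerBrDr.
rewrite !lebesgue_measure_itv/= !lte_fin ltrD2r.
by case: ifP => // _; congr EFin; ring.
Qed.

(** Pushing the measure forward along the translation reduces this to the
    invariance of the measure itself. *)
Lemma integral_lebesgue_shift (v : R) (h : RM -> \bar R) :
  measurable_fun setT h -> (forall x, 0 <= h x) ->
  \int[mu]_x h (x + v)%R = \int[mu]_x h x.
Proof.
move=> mh h0.
pose phi (x : RM) : RM := (x + v)%R.
have mphi : measurable_fun setT phi by exact: measurable_funD.
rewrite -[LHS](_ : \int[mu]_(x in phi @^-1` setT) (h \o phi) x = _); last first.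
  by rewrite preimage_setT.
rewrite -(ge0_integral_pushforward mphi)//=.
by apply: eq_measure_integral => //= A mA _; exact: lebesgue_measure_shift.
Qed.

(** The Cameron-Martin formula in dimension one: the two Gaussian densities
    centred at 0 and at v differ by an explicit exponential factor. *)
Lemma normal_shift (s v : R) (h : RM -> \bar R) : (0 < s)%R ->
  measurable_fun setT h -> (forall x, 0 <= h x) ->
  \int[normal_prob 0 s]_x h (x + v)%R =
  \int[normal_prob 0 s]_x
    (h x * (expR (v * x / s ^+ 2 - v ^+ 2 / (s ^+ 2 *+ 2)))%:E).
Proof.
move=> s0 mh h0.
have s1 : s != 0%R by rewrite gt_eqF.
have mE : measurable_fun setT (fun x : RM =>
    (expR (v * x / s ^+ 2 - v ^+ 2 / (s ^+ 2 *+ 2)))%:E).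
  apply/measurable_EFinP/measurableT_comp => //.
  by apply: measurable_funB => //; apply: measurable_funM => //; exact: measurable_funM.
have mS (c : R) : measurable_fun setT (fun x : RM => (x + c)%R : RM).
  exact: measurable_funD.
rewrite integral_normal_prob//; last by apply: (measurableT_comp mh (mS v)).
rewrite integral_normal_prob//; first last.
- by move=> x; rewrite mule_ge0// lee_fin expR_ge0.
- exact: emeasurable_funM.
rewrite -[LHS](integral_lebesgue_shift (- v)); first last.
- by move=> x; rewrite mule_ge0// lee_fin normal_pdf_ge0.
- apply: emeasurable_funM; first exact: (measurableT_comp mh (mS v)).
  by apply/measurable_EFinP; exact: measurable_normal_pdf.
apply: eq_integral => x _; rewrite subrK -muleA -EFinM; congr (_ * _%:E).
rewrite normal_pdfE// mulrCA; congr (_ * _)%R.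
rewrite /normal_fun -expRD; congr expR.
by field; rewrite ?mulf_neq0.
Qed.

End normal_shift.

Section gaussian_shift.
Context (R : realType).
Local Open Scope ereal_scope.
Local Notation RM := (measurableTypeR R).

Definition dotv (n : nat) (u v : 'cV[R]_n) : R :=
  (\sum_(i < n) u i ord0 * v i ord0)%R.

Lemma dotvDr n (u v w : 'cV[R]_n) : (dotv u (v + w) = dotv u v + dotv u w)%R.
Proof. by rewrite /dotv -big_split/=; apply: eq_bigr => i _; rewrite !mxE mulrDr. Qed.

Lemma dotvZr n a (u v : 'cV[R]_n) : (dotv u (a *: v) = a * dotv u v)%R.
Proof. by rewrite /dotv mulr_sumr; apply: eq_bigr => i _; rewrite !mxE mulrCA. Qed.

Lemma dotvC n (u v : 'cV[R]_n) : dotv u v = dotv v u.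
Proof. by apply: eq_bigr => i _; rewrite mulrC. Qed.

Lemma dotv_ge0 n (u : 'cV[R]_n) : (0 <= dotv u u)%R.
Proof. by apply: sumr_ge0 => i _; rewrite -expr2 sqr_ge0. Qed.

Lemma measurable_dotv d (T : measurableType d) n (u : 'cV[R]_n) (f : T -> 'cV[R]_n) :
  measurable_fun setT f -> measurable_fun setT (fun t => dotv u (f t) : RM).
Proof.
move=> mf; apply: measurable_sum => i; apply: measurable_funM => //.
exact: (measurableT_comp (measurable_coord i) mf).
Qed.

Lemma measurable_addv n (v : 'cV[R]_n) :
  measurable_fun setT (fun w : 'cV[R]_n => (w + v)%R).
Proof.
apply: measurable_fun_cV => i; under eq_fun do rewrite mxE.
by apply: measurable_funD => //; exact: measurable_coord.
Qed.

Lemma integral_gaussian0 (s : R) (h : 'cV[R]_0 -> \bar R) :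
  measurable_fun setT h -> \int[gaussian s 0]_w h w = h 0%R.
Proof. by move=> mh; rewrite integral_dirac// diracT mul1e. Qed.

(** The first coordinate is integrated separately, which is what inductions
    on the dimension need. *)
Lemma integral_gaussianS (s : R) n (h : 'cV[R]_n.+1 -> \bar R) :
  measurable_fun setT h -> (forall x, 0 <= h x) ->
  \int[gaussian s n.+1]_w h w =
  \int[normal_prob 0 s]_z \int[gaussian s n]_w h (cons_cV (z, w)).
Proof.
move=> mh h0.
rewrite (ge0_integral_pushforward (@measurable_cons_cV R n))// preimage_setT.
rewrite (@fubini_tonelli1 _ _ _ _ _ (normal_prob 0 s) (gaussian s n)).
- by [].
- exact: (measurableT_comp mh (@measurable_cons_cV R n)).
- by move=> x; exact: h0.
Qed.

(** The Cameron-Martin formula.  The inductive step translates the last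
    coordinates under the inner integral and the first one under the outer
    integral; the two exponential factors multiply. *)
Lemma gaussian_shift (s : R) n (v : 'cV[R]_n) (h : 'cV[R]_n -> \bar R) :
  (0 < s)%R -> measurable_fun setT h -> (forall x, 0 <= h x) ->
  \int[gaussian s n]_w h (w + v)%R =
  \int[gaussian s n]_w
    (h w * (expR (dotv v w / s ^+ 2 - dotv v v / (s ^+ 2 *+ 2)))%:E).
Proof.
move=> s0; elim: n v h => [|n IHn] v h mh h0.
  rewrite !integral_gaussian0//; last 2 first.
  - apply: emeasurable_funM => //; apply/measurable_EFinP/measurableT_comp => //.
    apply: measurable_funB => //; apply: measurable_funM => //.
    exact: measurable_dotv.
  - exact: (measurableT_comp mh (measurable_addv v)).
  rewrite /dotv !big_ord0 !mul0r subrr expR0 mule1; congr h.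
  by apply/matrixP => -[].
pose v' : 'cV[R]_n := (\col_i v (lift ord0 i) ord0)%R.
have mE : measurable_fun setT (fun w : 'cV[R]_n.+1 =>
    (expR (dotv v w / s ^+ 2 - dotv v v / (s ^+ 2 *+ 2)))%:E).
  apply/measurable_EFinP/measurableT_comp => //.
  apply: measurable_funB => //; apply: measurable_funM => //.
  exact: measurable_dotv.
rewrite integral_gaussianS//; last exact: (measurableT_comp mh (measurable_addv v)).
rewrite integral_gaussianS//; first last.
- by move=> w; rewrite mule_ge0// lee_fin expR_ge0.
- exact: emeasurable_funM.
have mpair (z : RM) : measurable_fun setT (fun w : 'cV[R]_n => @cons_cV R n (z, w)).
  apply: (measurableT_comp (@measurable_cons_cV R n)).
  exact: measurable_pair1.
transitivity (\int[normal_prob 0 s]_z \int[gaussian s n]_w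
    (h (cons_cV (z + v ord0 ord0, w)%R) *
     (expR (dotv v' w / s ^+ 2 - dotv v' v' / (s ^+ 2 *+ 2)))%:E)).
  apply: eq_integral => z _.
  rewrite -(IHn v' (fun w => h (cons_cV (z + v ord0 ord0, w)%R)))//; last first.
    exact: (measurableT_comp mh (mpair _)).
  apply: eq_integral => w _; congr h; apply/colP => i; rewrite !mxE.
  by case: unliftP => [j ->|->] //=; rewrite !mxE.
pose H (z : RM) := \int[gaussian s n]_w (h (cons_cV (z, w)%R) *
     (expR (dotv v' w / s ^+ 2 - dotv v' v' / (s ^+ 2 *+ 2)))%:E).
have mE' : measurable_fun setT (fun w : 'cV[R]_n =>
    (expR (dotv v' w / s ^+ 2 - dotv v' v' / (s ^+ 2 *+ 2)))%:E).
  apply/measurable_EFinP/measurableT_comp => //.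
  apply: measurable_funB => //; apply: measurable_funM => //.
  exact: measurable_dotv.
rewrite (@normal_shift R s (v ord0 ord0) H)//; first last.
- move=> z; apply: integral_ge0 => w _.
  by rewrite mule_ge0// lee_fin expR_ge0.
- apply: (@measurable_fun_fubini_tonelli_F _ _ RM 'cV[R]_n R (gaussian s n)
    (fun p => h (cons_cV p) *
     (expR (dotv v' p.2 / s ^+ 2 - dotv v' v' / (s ^+ 2 *+ 2)))%:E)).
  + apply: emeasurable_funM; first exact: (measurableT_comp mh (@measurable_cons_cV R n)).
    exact: (measurableT_comp mE' measurable_snd).
  + by move=> p; rewrite mule_ge0// lee_fin expR_ge0.
apply: eq_integral => z _; rewrite /H -ge0_integralZr//; first last.
- by move=> w _; rewrite mule_ge0// lee_fin expR_ge0.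
- by apply: emeasurable_funM => //; exact: (measurableT_comp mh (mpair _)).
apply: eq_integral => w _; rewrite -muleA -EFinM -expRD; congr (_ * (expR _)%:E).
rewrite /dotv !big_ord_recl !mxE unlift_none/=.
under [X in (_ = (_ + X) / _ - _)%R]eq_bigr do rewrite !mxE liftK.
under [X in (X / _ - _ + _ = _)%R]eq_bigr do rewrite !mxE.
under [X in (_ - X / _ + _ = _)%R]eq_bigr do rewrite !mxE.
by field; rewrite gt_eqF.
Qed.

End gaussian_shift.

(** * Expectations under Gaussian noise *)

Section gaussian_moments.
Context (R : realType).
Local Open Scope ereal_scope.
Local Notation RM := (measurableTypeR R).

Lemma dotvZl n a (u v : 'cV[R]_n) : (dotv (a *: u) v = a * dotv u v)%R.
Proof. by rewrite dotvC dotvZr dotvC. Qed.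

Lemma dotvNl n (u v : 'cV[R]_n) : (dotv (- u) v = - dotv u v)%R.
Proof. by rewrite -scaleN1r dotvZl mulN1r. Qed.

Lemma dotvNr n (u v : 'cV[R]_n) : (dotv u (- v) = - dotv u v)%R.
Proof. by rewrite dotvC dotvNl dotvC. Qed.

Lemma dotv0l n (u : 'cV[R]_n) : (dotv 0 u = 0)%R.
Proof. by rewrite -(scale0r u) dotvZl mul0r. Qed.

Lemma dotv_eq0 n (u : 'cV[R]_n) : (dotv u u == 0)%R = (u == 0%R).
Proof.
apply/idP/eqP => [|->]; last by rewrite dotv0l.
rewrite psumr_eq0 => [/allP h|i _]; last by rewrite -expr2 sqr_ge0.
apply/colP => i; rewrite mxE; apply/eqP.
by have := h i (mem_index_enum _); rewrite mulf_eq0 orbb.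
Qed.

Lemma dotv_gt0 n (u : 'cV[R]_n) : (0 < dotv u u)%R = (u != 0%R).
Proof. by rewrite lt_neqAle dotv_ge0 andbT eq_sym dotv_eq0. Qed.

Section nonneg_expectation.
Context (s : R) (n : nat).
Local Notation V := 'cV[R]_n.
Implicit Types f g : V -> RM.

(** Restricting to finite integrands lets the additivity and monotonicity rules
    below have measurability and sign conditions only on real functions. *)
Definition Egauss f : \bar R := \int[gaussian s n]_w (f w)%:E.

Lemma Egauss_cst (a : R) : Egauss (fun=> a) = a%:E.
Proof.
rewrite /Egauss (integral_cst (gaussian s n) measurableT).
by rewrite -[RHS]mule1; congr (_ * _); exact: probability_setT.
Qed.

Lemma Egauss_ge0 f : (forall w, 0 <= f w)%R -> 0 <= Egauss f.
Proof. by move=> f0; apply: integral_ge0 => w _; rewrite lee_fin. Qed.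

Lemma EgaussD f g : measurable_fun setT f -> measurable_fun setT g ->
  (forall w, 0 <= f w)%R -> (forall w, 0 <= g w)%R ->
  Egauss (fun w => f w + g w)%R = Egauss f + Egauss g.
Proof.
move=> mf mg f0 g0; rewrite /Egauss; under eq_integral do rewrite EFinD.
apply: ge0_integralD => //; try by move=> w _; rewrite lee_fin.
- exact/measurable_EFinP.
- exact/measurable_EFinP.
Qed.

Lemma EgaussZ (a : R) f : measurable_fun setT f -> (forall w, 0 <= f w)%R ->
  (0 <= a)%R -> Egauss (fun w => a * f w)%R = a%:E * Egauss f.
Proof.
move=> mf f0 a0; rewrite /Egauss; under eq_integral do rewrite EFinM.
apply: ge0_integralZl => //; try by move=> w _; rewrite lee_fin.
exact/measurable_EFinP.
Qed.

Lemma Egauss_le f g : measurable_fun setT f -> measurable_fun setT g ->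
  (forall w, 0 <= f w)%R -> (forall w, f w <= g w)%R -> Egauss f <= Egauss g.
Proof.
move=> mf mg f0 fg; apply: ge0_le_integral => //;
  try by move=> w _; rewrite lee_fin// (le_trans (f0 w)).
- exact/measurable_EFinP.
- exact/measurable_EFinP.
Qed.

Lemma Egauss_sum (I : Type) (r : seq I) (f : I -> V -> RM) :
  (forall i, measurable_fun setT (f i)) -> (forall i w, 0 <= f i w)%R ->
  Egauss (fun w => \sum_(i <- r) f i w)%R = \sum_(i <- r) Egauss (f i).
Proof.
move=> mf f0; elim: r => [|i r IHr].
  rewrite big_nil /Egauss; under eq_integral do rewrite big_nil.
  by rewrite integral0.
rewrite big_cons -IHr -EgaussD//; last 2 first.
- exact: measurable_sum.
- by move=> w; exact: sumr_ge0.
by apply: eq_integral => w _; rewrite big_cons.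
Qed.

End nonneg_expectation.

(** The density of N(v, s^2 I) with respect to N(0, s^2 I). *)
Definition likelihood (s : R) n (v w : 'cV[R]_n) : R :=
  expR (dotv v w / s ^+ 2 - dotv v v / (s ^+ 2 *+ 2)).

Lemma measurable_likelihood (s : R) n (v : 'cV[R]_n) :
  measurable_fun setT (likelihood s v : 'cV[R]_n -> RM).
Proof.
apply: measurableT_comp => //.
by apply: measurable_funB => //; apply: measurable_funM => //; exact: measurable_dotv.
Qed.

Lemma likelihood_ge0 (s : R) n (v w : 'cV[R]_n) : (0 <= likelihood s v w)%R.
Proof. exact: expR_ge0. Qed.

Lemma Egauss_shift (s : R) n (v : 'cV[R]_n) (f : 'cV[R]_n -> RM) : (0 < s)%R ->
  measurable_fun setT f -> (forall w, 0 <= f w)%R ->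
  Egauss s (fun w => f (w + v)%R) = Egauss s (fun w => f w * likelihood s v w)%R.
Proof.
move=> s0 mf f0; rewrite /Egauss (gaussian_shift v (h := fun w => (f w)%:E))//.
exact/measurable_EFinP.
Qed.

Lemma Egauss_likelihood (s : R) n (v : 'cV[R]_n) : (0 < s)%R ->
    Egauss s (likelihood s v) = 1.
Proof.
move=> s0; rewrite -(Egauss_cst s n 1) (Egauss_shift v (f := fun=> 1%R))//.
by apply: eq_integral => w _; rewrite mul1r.
Qed.

(** Le Cam's bound for the two hypotheses d and - d, with values r and - r to
    estimate.  After the change of measure, the two errors have weights p and q
    with p q constant.  The pointwise minimum of a^2 p + b^2 q under
    a + b = 2 r is 4 r^2 p q / (p + q); bounding 4 / (p + q) below by the affine
    function 4 - (p + q) leaves integrals that are known exactly. *)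
Lemma Egauss_two_point (s : R) n (d : 'cV[R]_n) (r : R) (g : 'cV[R]_n -> RM) :
  (0 < s)%R -> measurable_fun setT g ->
  (2 * r ^+ 2 * expR (- (dotv d d / s ^+ 2)))%:E <=
  Egauss s (fun w => (r - g (w + d)) ^+ 2)%R + Egauss s (fun w => (- r - g (w
      - d)) ^+ 2)%R.
Proof.
move=> s0 mg.
have m2 (a : R) : measurable_fun setT (fun w => (a - g w) ^+ 2 : RM)%R.
  by apply: measurable_funX; exact: measurable_funB.
rewrite (Egauss_shift d (f := fun w => (r - g w) ^+ 2)%R)//; last by move=> w;
  exact: sqr_ge0.
rewrite (Egauss_shift (- d) (f := fun w => (- r - g w) ^+ 2)%R)//; last by move=> w;
  exact: sqr_ge0.
set p := likelihood s d; set q := likelihood s (- d).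
have [mp mq] : measurable_fun setT (p : _ -> RM) /\ measurable_fun setT (q : _ -> RM).
  by split; exact: measurable_likelihood.
have p0 w : (0 < p w)%R by exact: expR_gt0.
have q0 w : (0 < q w)%R by exact: expR_gt0.
set k := expR (- (dotv d d / s ^+ 2)).
have k0 : (0 <= k)%R by exact: expR_ge0.
have pqE w : (p w * q w = k)%R.
  rewrite /p /q /likelihood -expRD /k; congr expR.
  by rewrite !dotvNl dotvNr; field; rewrite gt_eqF.
have F0 (a : R) u w : (0 <= u)%R -> (0 <= (a - g w) ^+ 2 * u)%R.
  by move=> u0; rewrite mulr_ge0// sqr_ge0.
rewrite -EgaussD//; first last.
- by move=> w; rewrite F0// ltW.
- by move=> w; rewrite F0// ltW.
- by apply: measurable_funM => //; exact: m2.
- by apply: measurable_funM => //; exact: m2.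
set J := Egauss _ _.
suff : (4 * r ^+ 2 * k)%:E <= J + (2 * r ^+ 2 * k)%:E.
  rewrite -leeBlDr// -EFinB; apply: le_trans; rewrite lee_fin -/k; lra.
have rk0 : (0 <= r ^+ 2 * k)%R by rewrite mulr_ge0// sqr_ge0.
rewrite (_ : (2 * r ^+ 2 * k)%:E = Egauss s (fun w => r ^+ 2 * k * (p w + q w))%R);
  last first.
  rewrite EgaussZ//; first last.
  - by move=> w; rewrite addr_ge0// ltW.
  - exact: measurable_funD.
  rewrite EgaussD//; try by move=> w; rewrite ltW.
  by rewrite !Egauss_likelihood// -EFinD -EFinM; congr EFin; ring.
rewrite /J -EgaussD//; first last.
- by move=> w; rewrite mulr_ge0// addr_ge0// ltW.
- by move=> w; rewrite addr_ge0// F0// ltW.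
- by apply: measurable_funM => //; exact: measurable_funD.
- by apply: measurable_funD; apply: measurable_funM => //; exact: m2.
rewrite -(Egauss_cst s n); apply: Egauss_le => //.
- apply: measurable_funD.
    by apply: measurable_funD; apply: measurable_funM => //; exact: m2.
  by apply: measurable_funM => //; exact: measurable_funD.
- by move=> w; rewrite -mulrA mulr_ge0.
move=> w; rewrite -(pqE w).
move: (p0 w) (q0 w); set P := p w; set Q := q w; set G := g w => P0 Q0.
(* After multiplication by P + Q, the difference of the two sides is a sum of
   squares with nonnegative weights. *)
have PQ : (0 < P + Q)%R by rewrite addr_gt0.
rewrite -subr_ge0 -(pmulr_rge0 _ PQ).
rewrite [leRHS](_ : _ = ((r - G) * P - (r + G) * Q) ^+ 2 +
  r ^+ 2 * (P * Q) * (P + Q - 2) ^+ 2)%R; last by ring.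
by rewrite addr_ge0 ?sqr_ge0// mulr_ge0 ?sqr_ge0// mulr_ge0 ?sqr_ge0// mulr_ge0// ltW.
Qed.

Lemma expR_half_le2 : (expR (2^-1 : R) <= 2)%R.
Proof.
have x0 : (0 < expR (2^-1 : R))%R by exact: expR_gt0.
have := expR_ge1Dx (- 2^-1 : R); rewrite expRN -(ler_pM2r x0) mulVf ?gt_eqF//.
lra.
Qed.

Lemma expRN1_ge : (4^-1 <= expR (-1 : R))%R.
Proof.
rewrite expRN lef_pV2 ?posrE ?expR_gt0//.
have -> : (1 = 2^-1 + 2^-1 :> R)%R by lra.
rewrite expRD; have := expR_half_le2; have := expR_gt0 (2^-1 : R); nra.
Qed.

Lemma sqr_le_expR (x : R) : (x ^+ 2 <= 4 * (expR x + expR (- x)))%R.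
Proof.
wlog x0 : x / (0 <= x)%R.
  move=> h; have [/h//|/ltW x0] := leP 0%R x.
  by have := h (- x)%R; rewrite oppr_ge0 sqrrN opprK addrC; exact.
have -> : (x = x / 2 + x / 2)%R by lra.
rewrite expRD; have := expR_ge1Dx (x / 2)%R.
have := expR_gt0 (- (x / 2 + x / 2))%R; nra.
Qed.

Lemma Egauss_exp (s : R) n (v : 'cV[R]_n) : (0 < s)%R ->
  Egauss s (fun w => expR (dotv v w)) = (expR (s ^+ 2 * dotv v v / 2))%:E.
Proof.
move=> s0.
have E w : (expR (dotv v w) = expR (s ^+ 2 * dotv v v / 2) *
    likelihood s (s ^+ 2 *: v) w)%R.
  rewrite /likelihood -expRD; congr expR; rewrite !(dotvZl, dotvZr).
  by field; rewrite gt_eqF.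
rewrite (_ : Egauss _ _ = Egauss s (fun w => expR (s ^+ 2 * dotv v v / 2) *
    likelihood s (s ^+ 2 *: v) w))%R; last first.
  by apply: eq_integral => w _; rewrite E.
rewrite EgaussZ ?expR_ge0//; last 2 first.
- exact: measurable_likelihood.
- by move=> w; exact: likelihood_ge0.
by rewrite Egauss_likelihood// mule1.
Qed.

Lemma measurable_expdot n (v : 'cV[R]_n) :
  measurable_fun setT (fun w : 'cV[R]_n => expR (dotv v w) : RM).
Proof. by apply: measurableT_comp => //; exact: measurable_dotv. Qed.

(** The square is dominated by exponentials at the scale where the exponential
    moment is a constant; the factor 16 in place of 1 is harmless. *)
Lemma Egauss_dotv_sqr_le (s : R) n (v : 'cV[R]_n) : (0 < s)%R ->
  Egauss s (fun w => dotv v w ^+ 2)%R <= (16 * s ^+ 2 * dotv v v)%:E.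
Proof.
move=> s0; have [->|v0] := eqVneq v 0%R.
  rewrite dotv0l mulr0 -(Egauss_cst s n 0%R) le_eqVlt; apply/orP; left; apply/eqP.
  by apply: eq_integral => w _; rewrite dotv0l expr0n.
pose N := (s ^+ 2 * dotv v v)%R.
have N0 : (0 < N)%R by rewrite mulr_gt0 ?exprn_gt0// dotv_gt0.
pose a := (Num.sqrt N)^-1%R.
have a2 : (a ^+ 2 = N^-1)%R by rewrite exprVn sqr_sqrtr// ltW.
pose e (x : R) w := expR (dotv (x *: v) w).
have me x : measurable_fun setT (e x : _ -> RM) by exact: measurable_expdot.
have e0 x w : (0 <= e x w)%R by exact: expR_ge0.
apply: (@le_trans _ _ (Egauss s (fun w => 4 * N * (e a w + e (- a) w)))%R).
  apply: Egauss_le => //.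
  - by apply: measurable_funX; exact: measurable_dotv.
  - by apply: measurable_funM => //; apply: measurable_funD; exact: me.
  - by move=> w; exact: sqr_ge0.
  move=> w; have := sqr_le_expR (a * dotv v w).
  rewrite exprMn a2 ler_pdivrMl// /e !dotvZl mulNr => /le_trans; apply.
  by rewrite mulrCA mulrA.
rewrite EgaussZ//; first last.
- by rewrite mulr_ge0// ltW.
- by move=> w; rewrite addr_ge0.
- by apply: measurable_funD; exact: me.
rewrite EgaussD//; try exact: me.
rewrite !Egauss_exp// !dotvZl !dotvZr !mulNr !mulrN opprK -EFinD -EFinM lee_fin.
have -> : (s ^+ 2 * (a * (a * dotv v v)) / 2 = 2^-1)%R.
  rewrite (_ : (_ / 2 = a ^+ 2 * N / 2)%R); last by rewrite /N; ring.
  by rewrite a2 mulVf ?gt_eqF// div1r.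
by have := expR_half_le2; rewrite -(mulrA 16%R) -/N; nra.
Qed.

(** The estimator g below is linear and such that in both hypotheses the error
    of [Egauss_two_point] is exactly the inner product with v. *)
Lemma Egauss_dotv_sqr_ge (s : R) n (v : 'cV[R]_n) : (0 < s)%R ->
  (s ^+ 2 * dotv v v / 4)%:E <= Egauss s (fun w => dotv v w ^+ 2)%R.
Proof.
move=> s0; have [->|v0] := eqVneq v 0%R.
  by rewrite dotv0l mulr0 mul0r; apply: Egauss_ge0 => w; exact: sqr_ge0.
pose N := dotv v v; have N0 : (0 < N)%R by rewrite dotv_gt0.
pose a := (s / Num.sqrt N)%R.
have a2 : (a ^+ 2 = s ^+ 2 / N)%R by rewrite expr_div_n sqr_sqrtr// ltW.
have := Egauss_two_point (a *: v) (a * N) s0 (g := dotv v)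
  (measurable_dotv v (measurable_id (D := setT))).
have -> : Egauss s (fun w => (a * N - dotv v (w + a *: v)) ^+ 2)%R =
    Egauss s (fun w => dotv v w ^+ 2)%R.
  by apply: eq_integral => w _; rewrite dotvDr dotvZr -/N; congr EFin; ring.
have -> : Egauss s (fun w => (- (a * N) - dotv v (w - a *: v)) ^+ 2)%R =
    Egauss s (fun w => dotv v w ^+ 2)%R.
  by apply: eq_integral => w _; rewrite dotvDr dotvNr dotvZr -/N; congr EFin; ring.
rewrite dotvZl dotvZr -/N mulrA -expr2 exprMn a2 divfK ?gt_eqF// divff; last first.
  by rewrite expf_eq0/= gt_eqF.
case: (Egauss s _) (Egauss_ge0 s (f := fun w => dotv v w ^+ 2)%R (fun w => sqr_ge0 _))
  => [E _|_ _|]; last 2 first.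
- by rewrite leey.
- by [].
rewrite -EFinD !lee_fin; have := expRN1_ge.
have : (0 < s ^+ 2 / N * N ^+ 2)%R by rewrite mulr_gt0 ?exprn_gt0 ?divr_gt0 ?exprn_gt0.
have -> : (s ^+ 2 / N * N ^+ 2 = s ^+ 2 * N)%R by field; rewrite gt_eqF.
set X := (s ^+ 2 * N)%R; set e := expR _ => X0 e4 h.
have : (0 <= e - 4^-1)%R by rewrite subr_ge0.
by move/(mulr_ge0 (ltW X0)); lra.
Qed.

End gaussian_moments.

(** * The spectral theorem for real symmetric matrices *)

Section spectral.
Context (R : realType).

(** The complexification of A is Hermitian, so it has a real eigenvalue l; then
    A - l is singular over the complex numbers, hence over the reals. *)
Lemma symmetric_eigen n (A : 'M[R]_n.+1) : A^T = A ->
  exists (l : R) (v : 'cV[R]_n.+1), v != 0 /\ A *m v = l *: v.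
Proof.
move=> symA; pose f := real_complex R; pose B := map_mx f A.
have hB : B \is hermsymmx.
  apply: realsym_hermsym.
    by apply/is_hermitianmxP; rewrite expr0 scale1r; apply/matrixP => i j;
      rewrite !mxE -{1}symA mxE.
  by apply/mxOverP => i j; rewrite mxE /f complex_real.
have /mxOverP/(_ ord0 ord0) dreal := hermitian_spectral_diag_real hB.
have := orthomx_spectralP (hermitian_normalmx hB).
set P := spectralmx B; set d := spectral_diag B; rewrite -/d in dreal => BE.
have uP : P \in unitmx by exact: spectral_unit.
have [l dl] : exists l : R, d ord0 ord0 = f l.
  by move/complex_realP : dreal => [l ->]; exists l.
have : ~~ row_free (A - l%:M).
  rewrite row_free_unit; apply/negP => uAl.
  have : map_mx f (A - l%:M) \in unitmx by rewrite map_unitmx.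
  rewrite map_mxB map_scalar_mx -/B => uBl.
  have : row ord0 (P *m (B - (f l)%:M)) = 0.
    rewrite mulmxBr {1}BE !mulmxA mulmxV// mul1mx mul_mx_scalar.
    by rewrite mul_diag_mx; apply/rowP => j; rewrite !mxE dl subrr.
  rewrite row_mul => /(congr1 (fun M => M *m invmx (B - (f l)%:M))).
  rewrite mul0mx -mulmxA mulmxV// mulmx1 => /(congr1 (fun M => M *m invmx P)).
  rewrite mul0mx -row_mul mulmxV// => /rowP/(_ ord0); rewrite !mxE eqxx.
  by move/eqP; rewrite oner_eq0.
rewrite -kermx_eq0 => /rowV0Pn[w /sub_kermxP].
rewrite mulmxBr mul_mx_scalar => /eqP; rewrite subr_eq0 => /eqP wA w0.
exists l, w^T; split; first by rewrite trmx_eq0.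
by rewrite -{1}symA -trmx_mul wA linearZ.
Qed.

(** The reflection that exchanges v with the first basis vector, or the identity
    when they agree. *)
Lemma householder n (v : 'cV[R]_n.+1) : v^T *m v = 1%:M ->
  exists H : 'M[R]_n.+1, [/\ H^T = H, H *m H = 1%:M & H *m v = delta_mx ord0 ord0].
Proof.
move=> v1; pose e : 'cV[R]_n.+1 := delta_mx ord0 ord0.
have [->|ve] := eqVneq v e.
  by exists 1%:M; rewrite trmx1 !mul1mx.
pose u := v - e; pose c := (u^T *m u) 0 0.
have uu : u^T *m u = c%:M by rewrite [LHS]mx11_scalar.
have uv : u^T *m v = (c / 2)%:M.
  have e1 : e^T *m e = 1%:M by rewrite trmx_delta mul_delta_mx [RHS]mx11_scalar mxE;
    apply/matrixP=> i j; rewrite !ord1 !mxE.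
  have ev : v^T *m e = e^T *m v.
    by rewrite [LHS]mx11_scalar
        -[in LHS](trmxK (v^T *m e)) trmx_mul trmxK [RHS]mx11_scalar mxE.
  have cE : c%:M = 2%:R *: (1%:M - e^T *m v) :> 'M[R]_1.
    rewrite -uu /u [(v - e)^T]linearB/= mulmxBl !mulmxBr v1 e1 ev scaler_nat mulr2n;
      by rewrite opprB addrA.
  apply: (@scalerI _ _ (2 : R)); first by rewrite pnatr_eq0.
  by rewrite /u [(v - e)^T]linearB/= mulmxBl v1
      -cE scale_scalar_mx mulrC divfK// pnatr_eq0.
have c0 : c != 0.
  apply: contraNneq ve => c0; rewrite -subr_eq0 -/u; apply/eqP/colP => i;
    rewrite [RHS]mxE.
  have : \sum_j u j 0 ^+ 2 = 0.
    by rewrite -[RHS]c0 /c [RHS]mxE; apply: eq_bigr => j _; rewrite [in RHS]mxE expr2.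
  move/eqP; rewrite psumr_eq0 => [/allP/(_ i (mem_index_enum _))|j _];
    last exact: sqr_ge0.
  by rewrite sqrf_eq0 => /eqP.
exists (1%:M - (2 / c) *: (u *m u^T)); split.
- by rewrite linearB/= trmx1 linearZ/= trmx_mul trmxK.
- rewrite mulmxBl mul1mx mulmxBr mulmx1 -scalemxAl -scalemxAr scalerA.
  rewrite -mulmxA (mulmxA u^T) uu mul_scalar_mx -scalemxAr scalerA.
  rewrite (_ : 2 / c * (2 / c) * c = 2 / c + 2 / c); last by field.
  rewrite scalerDl; set X := _ *: _.
  have -> : X - (X + X) = - X by rewrite opprD addrA subrr sub0r.
  by rewrite opprK subrK.
- rewrite mulmxBl mul1mx -scalemxAl -mulmxA uv mul_mx_scalar scalerA.
  rewrite (_ : 2 / c * (c / 2) = 1); last by field.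
  by rewrite scale1r /u opprB addrC subrK.
Qed.

(** Conjugating by a reflection that sends a unit eigenvector to the first basis
    vector splits off a diagonal entry. *)
Theorem real_spectral n (A : 'M[R]_n) : A^T = A ->
  exists (U : 'M[R]_n) (d : 'rV[R]_n),
    [/\ U *m U^T = 1%:M, U^T *m U = 1%:M & A = U *m diag_mx d *m U^T].
Proof.
suff h : A^T = A -> exists (U : 'M[R]_n) (d : 'rV[R]_n),
    U *m U^T = 1%:M /\ A = U *m diag_mx d *m U^T.
  by move=> /h[U [d [UU AE]]]; exists U, d; split => //; exact: mulmx1C.
elim: n A => [|n IHn] A symA.
  by exists 1%:M, 0; split; apply/matrixP => -[].
have [l [w [w0 Aw]]] := symmetric_eigen symA.
pose N := (w^T *m w) 0 0.
have N0 : 0 < N.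
  rewrite lt_neqAle /N mxE sumr_ge0 ?andbT; last first.
    by move=> i _; rewrite mxE -expr2 sqr_ge0.
  rewrite eq_sym psumr_eq0 => [|i _]; last by rewrite mxE -expr2 sqr_ge0.
  apply: contraNN w0 => /allP h; apply/eqP/colP => i; rewrite mxE.
  by have := h i (mem_index_enum _); rewrite mxE mulf_eq0 orbb => /eqP.
pose v := (Num.sqrt N)^-1 *: w.
have v1 : v^T *m v = 1%:M.
  rewrite /v [(_ *: w)^T]linearZ/= -scalemxAl
      -scalemxAr scalerA [w^T *m w]mx11_scalar -/N.
  by rewrite -expr2 exprVn sqr_sqrtr ?ltW// scale_scalar_mx mulVf ?gt_eqF.
have Av : A *m v = l *: v by rewrite -scalemxAr Aw !scalerA mulrC.
have [H [symH HH Hv]] := householder v1.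
have He : H *m delta_mx ord0 ord0 = v by rewrite -Hv mulmxA HH mul1mx.
pose B := H *m A *m H.
have symB : B^T = B by rewrite /B !trmx_mul symA symH mulmxA.
have Be : B *m delta_mx ord0 ord0 = l *: (delta_mx ord0 ord0 : 'cV[R]_n.+1).
  by rewrite /B -!mulmxA He Av -scalemxAr Hv.
have AE : A = H *m B *m H.
  by rewrite /B !mulmxA HH mul1mx -!mulmxA HH mulmx1.
clearbody B; pose B' : 'M[R]_n := drsubmx (B : 'M[R]_(1 + n)).
have BE : B = block_mx (l%:M : 'M[R]_1) 0 0 B'.
  have Bi0 i : B i ord0 = l *+ (i == ord0).
    have := congr1 (fun M : 'cV[R]_n.+1 => M i ord0) Be.
    rewrite !mxE (bigD1 ord0)//= big1 => [|j j0]; last first.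
      by rewrite mxE (negbTE j0) mulr0.
    by rewrite mxE !eqxx mulr1 addr0 andbT mulr_natr.
  rewrite -[LHS](@submxK _ 1 n 1 n).
  f_equal; apply/matrixP => i j; rewrite !mxE.
  - by rewrite !ord1 (_ : lshift n 0 = ord0) ?Bi0 ?eqxx//; exact/val_inj.
  - rewrite ord1 -symB mxE (_ : lshift n 0 = ord0) ?Bi0//; exact/val_inj.
  - by rewrite ord1 (_ : lshift n 0 = ord0) ?Bi0//; exact/val_inj.
have symB' : B'^T = B' by rewrite /B' trmx_drsub symB.
have [U' [d' [U1 BE']]] := IHn _ symB'.
pose W : 'M[R]_(1 + n) := block_mx 1%:M 0 0 U'.
have WW : W *m W^T = 1%:M.
  rewrite /W tr_block_mx mulmx_block !trmx1 !trmx0 !mulmx0 !mul0mx !mulmx1.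
  by rewrite !addr0 !add0r U1 -scalar_mx_block.
have WB : W *m diag_mx (row_mx (l%:M : 'M[R]_1) d') *m W^T = B.
  rewrite BE /W diag_mx_row tr_block_mx !mulmx_block.
  rewrite !trmx1 !trmx0 !mulmx0 !mul0mx !mulmx1 !mul1mx !addr0 !add0r -BE'.
  rewrite !mul0mx; congr block_mx; apply/matrixP => i j; by rewrite !ord1 !mxE.
exists (H *m W), (row_mx (l%:M : 'M[R]_1) d'); split.
  by rewrite trmx_mul symH mulmxA -(mulmxA H) WW mulmx1 HH.
by rewrite AE -WB trmx_mul symH !mulmxA.
Qed.

End spectral.

(** * Second moment relaxation of a polytope *)

Section relaxation.
Context (R : realType).

Lemma quad_diag p n (A : 'M[R]_(p, n)) (U : 'M[R]_n) (d : 'rV[R]_n) i :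
  (A *m (U *m diag_mx d *m U^T) *m A^T) i i = \sum_j d 0 j * (A *m U) i j ^+ 2.
Proof.
have -> : A *m (U *m diag_mx d *m U^T) *m A^T = A *m U *m diag_mx d *m (A *m U)^T.
  by rewrite trmx_mul !mulmxA.
rewrite mul_mx_diag !mxE; apply: eq_bigr => j _.
by rewrite !mxE expr2 mulrAC mulrC.
Qed.

Lemma trace_conj n (U D : 'M[R]_n) : U^T *m U = 1%:M -> \tr (U *m D *m U^T) = \tr D.
Proof. by move=> UU; rewrite mxtrace_mulC mulmxA UU mul1mx. Qed.

(** The trace of the inverse depends on the matrix only, so it can be computed
    in the basis V from the eigenvalues, and in the basis U from the
    Sherman-Morrison formula for the inverse of diag(e) + t z z^T. *)
Lemma trace_inv_rank1 n (U V : 'M[R]_n) (e g : 'rV[R]_n) (z : 'cV[R]_n) (t : R) :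
  0 <= t -> U *m U^T = 1%:M -> V *m V^T = 1%:M ->
  (forall j, 0 < e 0 j) -> (forall j, 0 < g 0 j) ->
  U *m (diag_mx e + t *: (z *m z^T)) *m U^T = V *m diag_mx g *m V^T ->
  \sum_j (g 0 j)^-1 = \sum_j (e 0 j)^-1 -
    t * (\sum_j z j 0 ^+ 2 / e 0 j ^+ 2) / (1 + t * \sum_j z j 0 ^+ 2 / e 0 j).
Proof.
move=> t0 UU VV e0 g0 E.
have UU' : U^T *m U = 1%:M by exact: mulmx1C.
have VV' : V^T *m V = 1%:M by exact: mulmx1C.
pose inv (d : 'rV[R]_n) := \row_j (d 0 j)^-1.
have invK (d : 'rV[R]_n) : (forall j, 0 < d 0 j) -> diag_mx d *m diag_mx (inv d) = 1%:M.
  move=> d0; rewrite mulmx_diag -diag_const_mx; congr diag_mx; apply/rowP => j.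
  by rewrite !mxE divff// gt_eqF.
pose q := \sum_j z j 0 ^+ 2 / e 0 j.
have q0 : 0 <= q by apply: sumr_ge0 => j _; rewrite divr_ge0 ?sqr_ge0// ltW.
have tq0 : 0 < 1 + t * q by rewrite ltr_pwDl// mulr_ge0.
pose y := diag_mx (inv e) *m z.
have yT : y^T = z^T *m diag_mx (inv e) by rewrite trmx_mul tr_diag_mx.
have zy : z^T *m y = q%:M.
  rewrite [LHS]mx11_scalar; congr (_%:M); rewrite mxE; apply: eq_bigr => j _.
  by rewrite /y mul_diag_mx !mxE expr2 mulrCA mulrC.
have ey : diag_mx e *m y = z by rewrite /y mulmxA invK// mul1mx.
have yE j : y j 0 = z j 0 / e 0 j by rewrite /y mul_diag_mx !mxE mulrC.
clearbody y.
pose W := diag_mx (inv e) - (t / (1 + t * q)) *: (y *m y^T).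
have MW : (diag_mx e + t *: (z *m z^T)) *m W = 1%:M.
  rewrite mulmxDl !mulmxBr invK// -!scalemxAl -!scalemxAr scalerA.
  have -> : diag_mx e *m (y *m y^T) = z *m y^T by rewrite mulmxA ey.
  have -> : z *m z^T *m diag_mx (inv e) = z *m y^T by rewrite yT mulmxA.
  have -> : z *m z^T *m (y *m y^T) = q *: (z *m y^T).
    by rewrite !mulmxA -(mulmxA z) zy mul_mx_scalar -scalemxAl.
  rewrite scalerA -addrA -[RHS]addr0; congr (_ + _).
  rewrite -scaleNr -!scalerBl -scalerDl (_ : _ + _ = 0) ?scale0r//.
  by field; rewrite gt_eqF.
have : \tr (V *m diag_mx (inv g) *m V^T) = \tr (U *m W *m U^T).
  congr mxtrace; set M := V *m diag_mx g *m V^T in E.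
  have M1 : M *m (V *m diag_mx (inv g) *m V^T) = 1%:M.
    rewrite /M -!mulmxA (mulmxA V^T) VV' mul1mx (mulmxA (diag_mx g)) invK//.
    by rewrite mul1mx.
  have M2 : M *m (U *m W *m U^T) = 1%:M.
    rewrite -E -!mulmxA (mulmxA U^T) UU' mul1mx (mulmxA (_ + _)) MW.
    by rewrite mul1mx.
  by rewrite -[LHS]mulmx1 -M2 mulmxA (mulmx1C M1) mul1mx.
rewrite !trace_conj// mxtrace_diag.
under eq_bigr do rewrite mxE.
move=> ->; rewrite /W linearB/= linearZ/= mxtrace_diag; congr (_ - _).
  by apply: eq_bigr => j _; rewrite mxE.
rewrite mulrAC; congr (t * _ / _).
rewrite mxtrace_mulC /mxtrace big_ord1 mxE; apply: eq_bigr => j _.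
by rewrite mxE -expr2 yE expr_div_n.
Qed.

(** The pair (U, v) stands for the matrix S = U diag(v) U^T; the last clause
    is a_i S a_i^T <= 1 for every row a_i of A. *)
Definition feasible m n (A : 'M[R]_(m, n)) (U : 'M[R]_n) (v : 'rV[R]_n) : Prop :=
  [/\ U *m U^T = 1%:M, forall j, 0 <= v 0 j &
      forall i, \sum_j v 0 j * (A *m U) i j ^+ 2 <= 1].

(** The trace of S (S + s^2)^-1, for S with eigenvalues v. *)
Definition shrunk_trace n (s : R) (v : 'rV[R]_n) : R := \sum_j v 0 j / (v 0 j + s ^+ 2).

Lemma shrunk_traceE n (s : R) (v : 'rV[R]_n) : 0 < s -> (forall j, 0 <= v 0 j) ->
  shrunk_trace s v = n%:R - s ^+ 2 * \sum_j (v 0 j + s ^+ 2)^-1.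
Proof.
move=> s0 v0; rewrite mulr_sumr.
have -> : n%:R = \sum_(j < n) (1 : R) by rewrite sumr_const card_ord.
rewrite -sumrB; apply: eq_bigr => j _; field.
by rewrite gt_eqF// ltr_wpDl// exprn_gt0.
Qed.

(** The pair (V, w) diagonalises (1 - t) S + t x x^T, which is feasible by
    convexity.  In the eigenbasis of S, adding s^2 to this matrix gives a
    diagonal matrix plus a multiple of z z^T, and [trace_inv_rank1] applies. *)
Lemma feasible_perturb m n (A : 'M[R]_(m, n)) (U : 'M[R]_n) (v : 'rV[R]_n)
    (x : 'cV[R]_n) (s t : R) :
  0 < s -> 0 <= t <= 1 -> feasible A U v -> (forall i, `|(A *m x) i 0| <= 1) ->
  let e j := (1 - t) * v 0 j + s ^+ 2 in let z := U^T *m x in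
  exists V w, feasible A V w /\
   shrunk_trace s w = n%:R - s ^+ 2 * (\sum_j (e j)^-1 -
    t * (\sum_j z j 0 ^+ 2 / e j ^+ 2) / (1 + t * \sum_j z j 0 ^+ 2 / e j)).
Proof.
move=> s0 /andP[t0 t1] [UU v0 Av] Ax e z.
have s20 : 0 < s ^+ 2 by rewrite exprn_gt0.
pose S := (1 - t) *: (U *m diag_mx v *m U^T) + t *: (x *m x^T).
have symS : S^T = S.
  by rewrite /S linearD/= !linearZ/= !trmx_mul !trmxK tr_diag_mx mulmxA.
have quadS p (B : 'M[R]_(p, n)) i : (B *m S *m B^T) i i =
    (1 - t) * (\sum_j v 0 j * (B *m U) i j ^+ 2) + t * (B *m x) i 0 ^+ 2.
  rewrite /S mulmxDr mulmxDl -!scalemxAr -!scalemxAl mxE [X in X + _]mxE.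
  rewrite quad_diag [X in _ + X]mxE; congr (_ + t * _).
  have -> : B *m (x *m x^T) *m B^T = (B *m x) *m (B *m x)^T.
    by rewrite trmx_mul !mulmxA.
  by rewrite mxE big_ord1 [X in _ * X]mxE expr2.
have [V [w [VV VV' SE]]] := real_spectral symS.
have w0 j : 0 <= w 0 j.
  have -> : w 0 j = (V^T *m S *m V^T^T) j j.
    rewrite trmxK SE -!mulmxA VV' mulmx1 mulmxA VV' mul1mx.
    by rewrite !mxE eqxx mulr1n.
  rewrite quadS addr_ge0// mulr_ge0 ?subr_ge0 ?sqr_ge0//.
  by apply: sumr_ge0 => k _; rewrite mulr_ge0 ?sqr_ge0.
exists V, w; split.
  split => // i; rewrite -quad_diag -SE quadS.
  have := Av i; have := Ax i; rewrite -ler_sqr ?nnegrE// expr1n real_normK ?num_real//.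
  nra.
rewrite shrunk_traceE//; congr (_ - _ * _).
pose e' := \row_j e j; pose g := \row_j (w 0 j + s ^+ 2).
have e0 j : 0 < e' 0 j by rewrite mxE /e ltr_wpDl// mulr_ge0// subr_ge0.
have g0 j : 0 < g 0 j by rewrite mxE ltr_wpDl.
have -> : \sum_j (w 0 j + s ^+ 2)^-1 = \sum_j (g 0 j)^-1.
  by apply: eq_bigr => j _; rewrite mxE.
suff UVE : U *m (diag_mx e' + t *: (z *m z^T)) *m U^T = V *m diag_mx g *m V^T.
  rewrite (trace_inv_rank1 t0 UU VV e0 g0 UVE); congr (_ - _ * _ / (1 + _ * _)).
  - by apply: eq_bigr => j _; rewrite [e' 0 j]mxE.
  - by apply: eq_bigr => j _; rewrite [e' 0 j]mxE.
  - by apply: eq_bigr => j _; rewrite [e' 0 j]mxE.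
have dE (d : 'rV[R]_n) (c : R) (Q : 'M[R]_n) : Q *m Q^T = 1%:M ->
    Q *m diag_mx (\row_j (d 0 j + c)) *m Q^T = Q *m diag_mx d *m Q^T + c%:M.
  move=> QQ; rewrite (_ : diag_mx _ = diag_mx d + c%:M); last first.
    by rewrite -diag_const_mx -linearD/=; congr diag_mx; apply/rowP=> j; rewrite !mxE.
  by rewrite mulmxDr mulmxDl mul_mx_scalar -scalemxAl QQ scalemx1.
rewrite dE// -SE mulmxDr mulmxDl /S.
rewrite (_ : e' = \row_j (((1 - t) *: v) 0 j + s ^+ 2)); last first.
  by apply/rowP => j; rewrite !mxE.
rewrite dE// addrAC; congr (_ + _ + _).
  by rewrite linearZ/= -scalemxAr -scalemxAl.
rewrite -scalemxAr -scalemxAl; congr (_ *: _).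
by rewrite /z trmx_mul trmxK !mulmxA UU mul1mx -(mulmxA _ U) UU mulmx1.
Qed.


Lemma feasible_pos m n (A : 'M[R]_(m, n)) (s : R) : (0 < n)%N -> 0 < s ->
  exists U v, feasible A U v /\ 0 < shrunk_trace s v.
Proof.
move=> n0 s0; pose K := 1 + \sum_i \sum_j A i j ^+ 2.
have K0 : 0 < K.
  by rewrite ltr_pwDl// sumr_ge0// => i _; apply: sumr_ge0 => j _; exact: sqr_ge0.
exists 1%:M, (const_mx K^-1); split; first split.
- by rewrite trmx1 mulmx1.
- by move=> j; rewrite mxE invr_ge0 ltW.
- move=> i; under eq_bigr do rewrite mxE mulmx1.
  rewrite -mulr_sumr mulrC ler_pdivrMr// mul1r /K (bigD1 i)//=.
  rewrite addrCA lerDl addr_ge0// sumr_ge0// => k _.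
  by apply: sumr_ge0 => j _; exact: sqr_ge0.
rewrite /shrunk_trace; under eq_bigr do rewrite mxE.
rewrite sumr_const card_ord pmulrn_lgt0// divr_gt0 ?invr_gt0//.
by rewrite addr_gt0 ?exprn_gt0 ?invr_gt0.
Qed.

Lemma shrunk_trace_le n (s : R) (v : 'rV[R]_n) : 0 < s -> (forall j, 0 <= v 0 j) ->
  shrunk_trace s v <= n%:R.
Proof.
move=> s0 v0; rewrite shrunk_traceE// gerBl mulr_ge0 ?sqr_ge0//.
by apply: sumr_ge0 => j _; rewrite invr_ge0 addr_ge0// sqr_ge0.
Qed.

(** A near maximum up to a factor 1 + t is enough for the comparison in
    [feasible_opt] and exists without compactness, since the supremum is
    positive and finite. *)
Lemma feasible_near_opt m n (A : 'M[R]_(m, n)) (s t : R) : (0 < n)%N -> 0 < s ->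
    0 < t <= 1 ->
  exists U v, [/\ feasible A U v, 0 < shrunk_trace s v &
    forall V w, feasible A V w -> shrunk_trace s w <= (1 + t) * shrunk_trace s v].
Proof.
move=> n0 s0 /andP[t0 t1].
pose F : set R := [set f | exists U v, feasible A U v /\ f = shrunk_trace s v].
have [U0 [v0 [fU0 f0]]] := feasible_pos A n0 s0.
have supF : has_sup F.
  split; first by exists (shrunk_trace s v0), U0, v0.
  by exists n%:R => _ [U [v [[_ v1 _] ->]]]; exact: shrunk_trace_le.
have F0 : 0 < sup F.
  by apply: (lt_le_trans f0); apply: ub_le_sup; [case: supF|exists U0, v0].
have e0 : 0 < sup F * (t / 2) by rewrite mulr_gt0// divr_gt0.
have [_ [U [v [fU ->]]] fv] := sup_adherent e0 supF.
exists U, v; split => //.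
  by apply: le_lt_trans fv; rewrite subr_ge0; nra.
move=> V w fV; apply: (@le_trans _ _ (sup F)).
  by apply: ub_le_sup; [case: supF|exists V, w].
nra.
Qed.

(** The first order optimality condition at (U, v), tested in the direction
    x x^T.  A derivative is avoided by comparing with a fixed small step t. *)
Lemma feasible_opt m n (A : 'M[R]_(m, n)) (s C : R) : (0 < n)%N -> 0 < s -> 0 <= C ->
  (forall x : 'cV[R]_n, (forall i, `|(A *m x) i 0| <= 1) ->
    \sum_j x j 0 ^+ 2 <= C) ->
  exists U v, [/\ feasible A U v, 0 < shrunk_trace s v &
    forall x : 'cV[R]_n, (forall i, `|(A *m x) i 0| <= 1) ->
    s ^+ 2 * \sum_j (U^T *m x) j 0 ^+ 2 / (v 0 j + s ^+ 2) ^+ 2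
      <= 6 * shrunk_trace s v].
Proof.
move=> n0 s0 C0 AC; have s20 : 0 < s ^+ 2 by rewrite exprn_gt0.
(* This step is at most 1/2, so that e and c below agree up to a factor 2, and
   makes the denominator 1 + t Q of the Sherman-Morrison formula at most 2. *)
pose t := s ^+ 2 / (2 * s ^+ 2 + C).
have tD : 0 < 2 * s ^+ 2 + C by rewrite ltr_pwDl// mulr_gt0.
have t0 : 0 < t by rewrite divr_gt0.
have t2 : t <= 2^-1 by rewrite ler_pdivrMr//; lra.
have tC : t * C <= s ^+ 2 by rewrite mulrAC ler_pdivrMr//; nra.
have [|U [v [fU f0 Uopt]]] := @feasible_near_opt m n A s t n0 s0.
  by rewrite t0; lra.
exists U, v; split => // x Ax; have [UU v0 _] := fU.
set z := U^T *m x.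
have zC : \sum_j z j 0 ^+ 2 <= C.
  apply: le_trans (AC x Ax).
  have E (y : 'cV[R]_n) : \sum_j y j 0 ^+ 2 = (y^T *m y) 0 0.
    by rewrite mxE; apply: eq_bigr => j _; rewrite mxE expr2.
  by rewrite !E /z trmx_mul trmxK -mulmxA (mulmxA U) UU mul1mx.
have [|V [w [fV]]] := feasible_perturb (t := t) s0 _ fU Ax.
  by rewrite ltW//=; lra.
pose e j := (1 - t) * v 0 j + s ^+ 2.
pose c j := v 0 j + s ^+ 2.
have c0 j : 0 < c j by rewrite /c ltr_wpDl.
have e0 j : 0 < e j by rewrite /e ltr_wpDl// mulr_ge0//; lra.
have ec j : e j <= c j by rewrite /e /c; have := v0 j; nra.
have ce j : c j <= 2 * e j by rewrite /e /c; have := v0 j; nra.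
have ceE j : c j - e j = t * v 0 j by rewrite /c /e; ring.
have sc j : s ^+ 2 <= c j by rewrite lerDr.
have se j : s ^+ 2 <= e j by rewrite lerDr mulr_ge0//; lra.
have stE : shrunk_trace s v = \sum_j v 0 j / c j by [].
have stE' : shrunk_trace s v = n%:R - s ^+ 2 * \sum_j (c j)^-1 by exact: shrunk_traceE.
pose Q := \sum_j z j 0 ^+ 2 / e j; pose Z := \sum_j z j 0 ^+ 2 / e j ^+ 2.
rewrite -/z -/e -/Q -/Z => wE.
have {wE}opt : n%:R - s ^+ 2 * (\sum_j (e j)^-1 - t * Z / (1 + t * Q)) <=
    (1 + t) * shrunk_trace s v by move: (Uopt _ _ fV); rewrite wE.
suff : s ^+ 2 * (\sum_j z j 0 ^+ 2 / c j ^+ 2) <= 6 * shrunk_trace s v by [].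
clearbody e c.
have tQ : 0 <= t * Q <= 1.
  have Q0 : 0 <= Q by apply: sumr_ge0 => j _; rewrite divr_ge0 ?sqr_ge0// ltW.
  rewrite (mulr_ge0 (ltW t0) Q0)/=.
  rewrite -(ler_pM2r s20) mul1r; apply: le_trans tC; rewrite -mulrA ler_pM2l//.
  apply: le_trans zC; rewrite mulr_suml ler_sum// => j _.
  by rewrite mulrAC ler_pdivrMr// ler_wpM2l ?sqr_ge0.
have Z0 : 0 <= Z by apply: sumr_ge0 => j _; rewrite divr_ge0 ?sqr_ge0// ltW// exprn_gt0.
have cZ : \sum_j z j 0 ^+ 2 / c j ^+ 2 <= Z.
  apply: ler_sum => j _; rewrite ler_wpM2l ?sqr_ge0// lef_pV2 ?posrE ?exprn_gt0//.
  by rewrite ler_sqr ?nnegrE ?ec // ltW.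
have diff : s ^+ 2 * (\sum_j (e j)^-1 - \sum_j (c j)^-1) <= t * (2 * shrunk_trace s v).
  rewrite -sumrB mulr_sumr stE !mulr_sumr; apply: ler_sum => j _.
  have -> : (e j)^-1 - (c j)^-1 = t * v 0 j / (e j * c j).
    by rewrite -ceE; field; rewrite !gt_eqF.
  have h : s ^+ 2 <= 2 * e j by exact: le_trans (sc j) (ce j).
  rewrite (_ : _ * _ = t * (v 0 j / c j) * (s ^+ 2 / e j)); last first.
    by field; rewrite !gt_eqF.
  rewrite (_ : t * (2 * _) = t * (v 0 j / c j) * 2); last by ring.
  rewrite ler_wpM2l ?ler_pdivrMr//.
  by rewrite (mulr_ge0 (ltW t0))// divr_ge0// ltW.
have : s ^+ 2 * (t * Z / (1 + t * Q)) <= t * (3 * shrunk_trace s v).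
  move: opt diff; rewrite mulrDl mul1r [X in _ <= X + _ -> _]stE'.
  set T := shrunk_trace s v; set E := \sum_j (e j)^-1; set D := \sum_j (c j)^-1.
  set Y := t * Z / (1 + t * Q).
  lra.
have -> : s ^+ 2 * (t * Z / (1 + t * Q)) = t * (s ^+ 2 * Z / (1 + t * Q)) by ring.
rewrite ler_pM2l// ler_pdivrMr; last by lra.
have : s ^+ 2 * (\sum_j z j 0 ^+ 2 / c j ^+ 2) <= s ^+ 2 * Z by rewrite ler_pM2l.
have := mulr_ge0 (ltW f0) (_ : 0 <= 1 - t * Q).
have -> : 0 <= 1 - t * Q by lra.
move=> /(_ isT); nra.
Qed.

End relaxation.

(** * Random signs *)

Section hypercube.
Context (R : realType).

(** For small x this follows from exp y <= 1 / (1 - y), for large x from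
    |x| <= 2 x^2.  The optimal exponent is x^2 / 2. *)
Lemma cosh_le (x : R) : expR x + expR (- x) <= 2 * expR (2 * x ^+ 2).
Proof.
have [x2|x2] := leP (x ^+ 2) 2^-1.
  have x1 : 0 < 1 - x ^+ 2 by lra.
  have e1 (y : R) : `|y| < 1 -> expR y <= (1 - y)^-1.
    move=> y1; have y0 : 0 < 1 - y by move: y1; rewrite ltr_norml; lra.
    rewrite -[leLHS]invrK lef_pV2 ?posrE ?invr_gt0 ?expR_gt0// -expRN.
    exact: expR_ge1Dx.
  have nx : `|x| < 1 by rewrite -ltr_sqr ?nnegrE// real_normK ?num_real// expr1n; lra.
  have nNx : `|- x| < 1 by rewrite normrN.
  apply: le_trans (lerD (e1 _ nx) (e1 _ nNx)) _.
  have -> : (1 - x)^-1 + (1 - - x)^-1 = 2 / (1 - x ^+ 2).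
    move: nx; rewrite ltr_norml => /andP[xl xr].
    by field; rewrite !gt_eqF//; lra.
  rewrite ler_pM2l//; apply: le_trans (expR_ge1Dx _).
  by rewrite -[leLHS]mul1r ler_pdivrMr//; nra.
have xe (y : R) : y ^+ 2 = x ^+ 2 -> expR y <= expR (2 * x ^+ 2).
  move=> yx; rewrite ler_expR -yx.
  have [y0|y0] := leP y 0; first by apply: (le_trans y0); rewrite mulr_ge0 ?sqr_ge0.
  by move: x2; rewrite -yx; nra.
by rewrite mulr_natl mulr2n lerD// xe// sqrrN.
Qed.

Lemma sum_expR_signs n (c : 'I_n -> R) :
  \sum_(b : {ffun 'I_n -> bool}) expR (\sum_j (-1) ^+ b j * c j)
    <= 2 ^+ n * expR (2 * \sum_j c j ^+ 2).
Proof.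
under eq_bigr do rewrite expR_sum.
rewrite -(bigA_distr_bigA (fun j (b : bool) => expR ((-1) ^+ b * c j))).
have -> : 2 ^+ n = \prod_(j < n) (2 : R) by rewrite prodr_const card_ord.
rewrite mulr_sumr expR_sum -big_split/=.
apply: ler_prod => j _; rewrite big_bool /= addrC expr0 mul1r expr1 mulN1r.
by rewrite cosh_le addr_ge0// expR_ge0.
Qed.

(** Hoeffding's inequality, with the constant 1/8 in place of 1/2 in the
    exponent because of [cosh_le]. *)
Lemma hoeffding_signs n (c : 'I_n -> R) (L : R) : 0 < L ->
  L * \sum_j c j ^+ 2 <= 1 ->
  #|[pred b : {ffun 'I_n -> bool} | 1 < `|\sum_j (-1) ^+ b j * c j|]|%:R
    <= 2 * (2 ^+ n * expR (- (L / 8))).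
Proof.
move=> L0 Lc; set B := [pred b | _].
(* L / 4 minimises the exponent 2 l^2 / L - l of the Chernoff bound. *)
pose l := L / 4; pose S (b : {ffun 'I_n -> bool}) := \sum_j (-1) ^+ b j * c j.
have lsum (l' : R) : l' ^+ 2 = l ^+ 2 ->
    \sum_b expR (l' * S b) <= 2 ^+ n * expR (L / 8).
  move=> ll; have := sum_expR_signs (fun j => l' * c j).
  rewrite (eq_bigr (fun b => expR (l' * S b))) => [/le_trans|b _]; last first.
    by congr expR; rewrite mulr_sumr; apply: eq_bigr => j _; rewrite mulrCA.
  apply; rewrite ler_pM2l ?exprn_gt0// ler_expR.
  under eq_bigr do rewrite exprMn ll.
  by rewrite -mulr_sumr /l; nra.
have : #|B|%:R * expR l <= \sum_b (expR (l * S b) + expR (- l * S b)).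
  rewrite mulr_natl -sumr_const [leRHS](bigID (mem B))/= -[leLHS]addr0.
  apply: lerD; last by apply: sumr_ge0 => b _; rewrite addr_ge0 ?expR_ge0.
  apply: ler_sum => b; rewrite inE -/(S b) => Sb.
  have l0 : 0 < l by rewrite divr_gt0.
  move: Sb; rewrite lter_normr => /orP[Sb|Sb].
    by rewrite -[leLHS]addr0 lerD ?expR_ge0// ler_expR; nra.
  by rewrite -[leLHS]add0r lerD ?expR_ge0// ler_expR; nra.
rewrite big_split/= -ler_pdivlMr ?expR_gt0// => /le_trans; apply.
rewrite ler_pdivrMr ?expR_gt0// -!mulrA -expRD.
have -> : - (L / 8) + l = L / 8 by rewrite /l; lra.
have := lsum l erefl; have := lsum (- l); rewrite sqrrN => /(_ erefl); lra.
Qed.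

End hypercube.

(** * The hypercube lower bound on the minimax risk *)

Section assouad.
Context (R : realType).
Local Notation RM := (measurableTypeR R).

Lemma enorm_sqr n (x : 'cV[R]_n) : enorm x ^+ 2 = dotv x x.
Proof.
rewrite /enorm sqr_sqrtr; first by apply: eq_bigr => i _; rewrite expr2.
by apply: sumr_ge0 => i _; rewrite sqr_ge0.
Qed.

Lemma mulmx_dotv m n (U : 'M[R]_(m, n)) (x : 'cV[R]_m) j :
  (U^T *m x) j ord0 = dotv (col j U) x.
Proof. by rewrite mxE; apply: eq_bigr => i _; rewrite !mxE. Qed.

Lemma dotvE n (x y : 'cV[R]_n) : dotv x y = (x^T *m y) 0 0.
Proof. by rewrite mxE; apply: eq_bigr => i _; rewrite mxE. Qed.

Lemma parseval n (U : 'M[R]_n) (x : 'cV[R]_n) : U *m U^T = 1%:M ->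
  dotv x x = \sum_j dotv (col j U) x ^+ 2.
Proof.
move=> UU; have -> : dotv x x = dotv (U^T *m x) (U^T *m x).
  by rewrite !dotvE trmx_mul trmxK -mulmxA (mulmxA U) UU mul1mx.
by apply: eq_bigr => j _; rewrite mulmx_dotv expr2.
Qed.

Lemma measurable_addvl n (v : 'cV[R]_n) :
  measurable_fun setT (fun w : 'cV[R]_n => v + w).
Proof.
rewrite (_ : (fun w => _) = (fun w => w + v)); first exact: measurable_addv.
by apply/funext => w; rewrite addrC.
Qed.

Lemma mean_sq_errE n (s : R) M (x : 'cV[R]_n) :
  mean_sq_err s M x = Egauss s (fun w => dotv (x - M (x + w)) (x - M (x + w))).
Proof.
by rewrite /mean_sq_err unlock; apply: eq_integral => w _; rewrite enorm_sqr.
Qed.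

Section vertices.
Context (n : nat) (U : 'M[R]_n) (r : 'I_n -> R) (UU : U *m U^T = 1%:M).
Implicit Types b : {ffun 'I_n -> bool}.

Definition vertex b : 'cV[R]_n := \sum_j ((-1) ^+ b j * r j) *: col j U.

Definition flip j b : {ffun 'I_n -> bool} := [ffun i => b i (+) (i == j)].

Lemma flipK j : involutive (flip j).
Proof. by move=> b; apply/ffunP => i; rewrite !ffunE -addbA addbb addbF. Qed.

Lemma vertex_flip j b : vertex (flip j b)
    = vertex b - (2 * ((-1) ^+ b j * r j)) *: col j U.
Proof.
rewrite /vertex (bigD1 j)//= [X in _ = X - _](bigD1 j)//= addrAC; congr (_ + _).
  by rewrite ffunE eqxx addbT signrN -scalerBl; congr (_ *: _); ring.
by apply: eq_bigr => i /negbTE ij; rewrite ffunE ij addbF.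
Qed.

Lemma dotv_col i j : dotv (col i U) (col j U) = (i == j)%:R.
Proof.
rewrite -mulmx_dotv mxE; have /matrixP/(_ i j) := mulmx1C UU.
by rewrite !mxE => <-; apply: eq_bigr => k _; rewrite !mxE.
Qed.

Context (s : R) (M : 'cV[R]_n -> 'cV[R]_n).
Context (s0 : 0 < s) (r0 : forall j, 0 <= r j <= s) (mM : measurable_fun setT M).

(** The part of the risk at a vertex that is along the axis j. *)
Definition coord_risk j b : \bar R :=
  Egauss s (fun w => dotv (col j U) (vertex b - M (vertex b + w)) ^+ 2).

Lemma coord_risk_ge0 j b : (0 <= coord_risk j b)%E.
Proof. by apply: Egauss_ge0 => w; exact: sqr_ge0. Qed.

Lemma mean_sq_err_vertex b : mean_sq_err s M (vertex b) = (\sum_j coord_risk j b)%E.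
Proof.
rewrite mean_sq_errE -Egauss_sum => [|j|j w]; last exact: sqr_ge0.
- by apply: eq_integral => w _; rewrite (parseval _ UU).
- apply: measurable_funX; apply: measurable_dotv.
  apply: measurable_fun_cV => i; under eq_fun do rewrite !mxE.
  apply: measurable_funB => //.
  apply: (measurableT_comp (measurable_coord i)).
  exact: (measurableT_comp mM (measurable_addvl _)).
Qed.

(** Two vertices that differ in the sign j only are at distance 2 r_j along the
    axis j; [Egauss_two_point] applies around their midpoint c.  Since r_j <= s,
    its exponential factor is at least 1/4. *)
Lemma coord_risk_flip j b :
  ((r j ^+ 2 / 2)%:E <= coord_risk j b + coord_risk j (flip j b))%E.
Proof.
pose u := col j U; pose p := (-1) ^+ b j * r j; pose d := p *: u.
have uu : dotv u u = 1 by rewrite dotv_col eqxx.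
have p2 : p ^+ 2 = r j ^+ 2 by rewrite exprMn sqrr_sign mul1r.
pose c := vertex b - d; pose g z : RM := dotv u (M (c + z) - c).
have mg : measurable_fun setT g.
  apply: measurable_dotv; apply: (measurableT_comp (measurable_addv (- c))).
  exact: (measurableT_comp mM (measurable_addvl _)).
have := Egauss_two_point d p s0 mg.
have -> : Egauss s (fun w => (p - g (w + d)) ^+ 2) = coord_risk j b.
  apply: eq_integral => w _; congr (_ ^+ 2)%:E; rewrite /g -/u.
  have -> : c + (w + d) = vertex b + w by rewrite /c addrCA subrK addrC.
  have -> : p = dotv u d by rewrite dotvZr uu mulr1.
  rewrite -dotvNr -dotvDr; congr dotv; rewrite opprB addrA /c; congr (_ - _).
  by rewrite addrC subrK.
have -> : Egauss s (fun w => (- p - g (w - d)) ^+ 2) = coord_risk j (flip j b).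
  apply: eq_integral => w _; congr (_ ^+ 2)%:E; rewrite /g -/u.
  have vE : vertex (flip j b) = c - d.
    by rewrite vertex_flip -/p -/u /c -addrA -opprD -scalerDl mulr_natl mulr2n.
  have -> : c + (w - d) = vertex (flip j b) + w by rewrite vE addrCA addrC.
  have -> : - p = dotv u (- d) by rewrite dotvNr dotvZr uu mulr1.
  rewrite -dotvNr -dotvDr; congr dotv; rewrite opprB addrA vE; congr (_ - _).
  by rewrite addrC.
apply: le_trans; rewrite lee_fin dotvZr dotvZl uu mulr1 -expr2 p2.
have /andP[rj0 rjs] := r0 j.
have h : expR (-1) <= expR (- (r j ^+ 2 / s ^+ 2)).
  rewrite ler_expR lerN2 ler_pdivrMr ?exprn_gt0// mul1r.
  by rewrite ler_sqr ?nnegrE// ltW.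
have := le_trans (expRN1_ge R) h; have := sqr_ge0 (r j); nra.
Qed.

Context (G : pred {ffun 'I_n -> bool}) (X : set 'cV[R]_n).
Context (GX : forall b, G b -> X (vertex b)).
Context (Gbad : (4 * #|[predC G]| <= 2 ^ n)%N).

Lemma card_good_pairs j : (2 ^ n <= 2 * #|[pred b | G b && G (flip j b)]|)%N.
Proof.
have card2 : #|{: {ffun 'I_n -> bool}}| = (2 ^ n)%N.
  by rewrite card_ffun card_bool card_ord.
have : (#|[predC [pred b | G b && G (flip j b)]]| <= #|[predC G]| + #|[predC G]|)%N.
  have E : #|[pred b | ~~ G (flip j b)]| = #|[predC G]|.
    rewrite -!sum1_card [RHS](reindex_inj (inv_inj (flipK j)))/=.
    by apply: eq_bigl => b; rewrite !inE.
  rewrite -[X in (_ <= _ + X)%N]E -cardUI; apply: leq_trans (leq_addr _ _);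
    apply: subset_leq_card.
  by apply/fintype.subsetP => b; rewrite !inE negb_and.
have := cardC [pred b | G b && G (flip j b)]; rewrite card2.
move: Gbad; set x := #|_|; set y := #|_|; set z := #|_|; lia.
Qed.

(** Pairing every good vertex with its neighbour across the axis j loses only the
    pairs with a bad vertex, at most half of all pairs. *)
Lemma sum_coord_risk j :
  ((2 ^+ n * (r j ^+ 2 / 8))%:E <= \sum_(b | G b) coord_risk j b)%E.
Proof.
set S := (\sum_(b | _) _)%E.
have S0 : (0 <= S)%E by apply: sume_ge0 => b _; exact: coord_risk_ge0.
suff : ((2 ^+ n * (r j ^+ 2 / 4))%:E <= S + S)%E.
  case: S S0 => [x| |]//= _; rewrite ?leey//.
  by rewrite -EFinD !lee_fin; lra.
have -> : (S + S = S + \sum_(b | G (flip j b)) coord_risk j (flip j b))%E.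
  by congr (_ + _)%E; rewrite /S (reindex_inj (inv_inj (flipK j))).
apply: (@le_trans _ _ (\sum_(b | G b && G (flip j b))
    (coord_risk j b + coord_risk j (flip j b)))%E).
  apply: (@le_trans _ _ (\sum_(b | G b && G (flip j b)) (r j ^+ 2 / 2)%:E)%E).
    rewrite sumEFin lee_fin sumr_const -[leRHS]mulr_natl.
    rewrite (_ : #|_| = #|[pred b | G b && G (flip j b)]|); last exact: eq_card.
    have : (2 ^+ n : R) <= 2 * #|[pred b | G b && G (flip j b)]|%:R.
      by rewrite -natrX -natrM ler_nat card_good_pairs.
    by move/(ler_wpM2r (sqr_ge0 (r j))); lra.
  by apply: lee_sum => b _; exact: coord_risk_flip.
rewrite big_split/=; apply: leeD.
  by apply: lee_sum_nneg => b _ _; exact: coord_risk_ge0.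
under eq_bigl do rewrite andbC.
by apply: lee_sum_nneg => b _ _; exact: coord_risk_ge0.
Qed.

(** The worst risk exceeds the average over the good vertices, and the risk at a
    vertex is the sum of its parts along the axes. *)
Theorem assouad : ((\sum_j r j ^+ 2 / 8)%:E <= worst_risk X s M)%E.
Proof.
set W := worst_risk X s M.
have mW b : G b -> (\sum_j coord_risk j b <= W)%E.
  move=> Gb; rewrite -mean_sq_err_vertex; apply: ereal_sup_ubound.
  by exists (vertex b) => //; exact: GX.
have card2 : #|{: {ffun 'I_n -> bool}}| = (2 ^ n)%N.
  by rewrite card_ffun card_bool card_ord.
have W0 : (0 <= W)%E.
  have /existsP[b Gb] : [exists b, G b].
    apply: contraTT Gbad => /existsPn noG; rewrite -ltnNge.
    have -> : #|[predC G]| = (2 ^ n)%N.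
      by rewrite -card2; apply: eq_card => b; rewrite !inE noG.
    by have := expn_gt0 2 n; lia.
  by apply: le_trans (mW b Gb); apply: sume_ge0 => j _; exact: coord_risk_ge0.
have p0 : (0 < (2 ^+ n : R)%:E)%E by rewrite lte_fin exprn_gt0.
rewrite -(lee_pmul2l _ p0)//.
apply: (@le_trans _ _ (\sum_(b | G b) \sum_j coord_risk j b)%E).
  rewrite exchange_big/= -EFinM mulr_sumr -sumEFin.
  by apply: lee_sum => j _; exact: sum_coord_risk.
apply: (@le_trans _ _ (\sum_(b | G b) W)%E); first exact: lee_sum.
case: W W0 {mW} => [x x0| _|]//; last first.
  by rewrite gt0_muley// leey.
rewrite sumEFin -EFinM lee_fin sumr_const -[leLHS]mulr_natl ler_wpM2r// -natrX ler_nat.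
by rewrite -card2 max_card.
Qed.

End vertices.
End assouad.

(** * Upper bound on the ratio of the risks *)

Section projections.
Context (R : realType).
Local Notation RM := (measurableTypeR R).

Lemma dotvBl n (u v w : 'cV[R]_n) : dotv (u - v) w = dotv u w - dotv v w.
Proof. by rewrite dotvC dotvDr dotvNr ![dotv w _]dotvC. Qed.

Lemma dotv_trmx m n (B : 'M[R]_(m, n)) (u : 'cV[R]_m) (w : 'cV[R]_n) :
  dotv u (B *m w) = dotv (B^T *m u) w.
Proof. by rewrite !dotvE trmx_mul trmxK mulmxA. Qed.

Section noise.
Context (n : nat) (P : 'M[R]_n) (PP : orthogonal_projection P) (s : R) (s0 : 0 < s).

(** The bias x - P x is orthogonal to the range of P, so there is no cross
    term. *)
Lemma mean_sq_err_proj (x : 'cV[R]_n) :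
  mean_sq_err s (fun y => P *m y) x =
  ((dotv (x - P *m x) (x - P *m x))%:E + Egauss s (fun w => dotv (P *m w) (P *m w)))%E.
Proof.
have [idP symP] := PP.
set a := x - P *m x.
have aw w : dotv a (P *m w) = 0.
  by rewrite dotv_trmx symP /a mulmxBr mulmxA idP subrr dotv0l.
rewrite mean_sq_errE -(Egauss_cst s n) -EgaussD//; first last.
- by move=> w; exact: dotv_ge0.
- by move=> w; exact: dotv_ge0.
- apply: measurable_sum => i; apply: measurable_funM; under eq_fun do rewrite mxE;
  by apply: measurable_sum => j; apply: measurable_funM => //; exact: measurable_coord.
apply: eq_integral => w _; congr EFin.
rewrite mulmxDr opprD addrA -/a; clearbody a.
rewrite dotvDr dotvNr !dotvBl aw [dotv (P *m w) a]dotvC aw; ring.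
Qed.

Lemma proj_noiseE : Egauss s (fun w => dotv (P *m w) (P *m w)) =
  (\sum_i Egauss s (fun w => (dotv (col i P) w ^+ 2)%R))%E.
Proof.
have [_ symP] := PP.
rewrite -Egauss_sum => [|i|i w]; last exact: sqr_ge0.
- apply: eq_integral => w _; congr EFin; apply: eq_bigr => i _.
  by rewrite -{1 2}symP mulmx_dotv expr2.
- by apply: measurable_funX; exact: measurable_dotv.
Qed.

Lemma tr_proj : \tr P = \sum_i dotv (col i P) (col i P).
Proof.
have [idP symP] := PP.
apply: eq_bigr => i _; rewrite -{1}idP -{1}symP mxE.
by apply: eq_bigr => j _; rewrite !mxE.
Qed.

Lemma proj_noise_le : (Egauss s (fun w => dotv (P *m w) (P *m w))
    <= (16 * s ^+ 2 * \tr P)%:E)%E.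
Proof.
rewrite proj_noiseE tr_proj mulr_sumr -sumEFin; apply: lee_sum => i _.
exact: Egauss_dotv_sqr_le.
Qed.

Lemma proj_noise_ge : ((s ^+ 2 * \tr P / 4)%:E
    <= Egauss s (fun w => dotv (P *m w) (P *m w)))%E.
Proof.
rewrite proj_noiseE tr_proj mulr_sumr mulr_suml -sumEFin; apply: lee_sum => i _.
exact: Egauss_dotv_sqr_ge.
Qed.

End noise.

(** The orthogonal projection on the span of the columns of U in I. *)
Definition coord_proj n (U : 'M[R]_n) (I : pred 'I_n) : 'M[R]_n :=
  U *m diag_mx (\row_j (I j)%:R) *m U^T.

Lemma coord_projP n (U : 'M[R]_n) I : U *m U^T = 1%:M ->
  orthogonal_projection (coord_proj U I).
Proof.
move=> UU; have UU' := mulmx1C UU; split.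
  rewrite /coord_proj -!mulmxA (mulmxA U^T) UU' mul1mx (mulmxA (diag_mx _)) mulmx_diag.
  congr (_ *m (diag_mx _ *m _)); apply/rowP => j; rewrite !mxE.
  by case: (I j); rewrite ?mulr1 ?mulr0.
by rewrite /coord_proj !trmx_mul trmxK tr_diag_mx mulmxA.
Qed.

Lemma tr_coord_proj n (U : 'M[R]_n) I : U *m U^T = 1%:M ->
  \tr (coord_proj U I) = \sum_(j | I j) 1.
Proof.
move=> /mulmx1C UU; rewrite trace_conj// mxtrace_diag [RHS]big_mkcond.
by apply: eq_bigr => j _; rewrite mxE; case: (I j).
Qed.

Lemma coord_proj_err n (U : 'M[R]_n) I (x : 'cV[R]_n) : U *m U^T = 1%:M ->
  dotv (x - coord_proj U I *m x) (x - coord_proj U I *m x) =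
  \sum_(j | ~~ I j) (U^T *m x) j ord0 ^+ 2.
Proof.
move=> UU; have UU' := mulmx1C UU.
rewrite (parseval _ UU) [RHS]big_mkcond; apply: eq_bigr => j _.
rewrite -mulmx_dotv mulmxBr /coord_proj -!mulmxA (mulmxA U^T) UU' mul1mx.
move: (U^T *m x) => z; rewrite mul_diag_mx !mxE.
by case: (I j); rewrite ?mul1r ?mul0r ?subr0 ?subrr ?expr0n.
Qed.

End projections.

Section upper_bound.
Context (R : realType).

Lemma mx_norm_leP m n (A : 'M[R]_(m, n)) (c : R) : 0 <= c ->
  `|A| <= c <-> forall i j, `|A i j| <= c.
Proof.
move=> c0; have -> : `|A| = mx_norm A by [].
rewrite mx_normrE; split => [h i j|h].
  by apply: le_trans h; exact: (le_bigmax _ (fun k => `|A k.1 k.2|) (i, j)).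
by apply/bigmax_leP; split => // -[i j] _; exact: h.
Qed.

Definition body m n (A : 'M[R]_(m, n)) : set 'cV[R]_n :=
  [set x | forall i, `|(A *m x) i ord0| <= 1].

Lemma bodyE m n (A : 'M[R]_(m, n)) : [set x : 'cV[R]_n | `|A *m x| <= 1] = body A.
Proof.
apply/seteqP; split => x /= => [/(mx_norm_leP _ ler01) h i|h]; first exact: h.
by apply/(mx_norm_leP _ ler01) => i j; rewrite ord1.
Qed.

(** The directions with v_j > s^2 contribute at most 16 s^2 each to the noise,
    and s^2 = k_j there; the others have (v_j + s^2)^2 <= 4 s^4, so that
    [feasible_opt] controls the bias by 24 sum_j k_j. *)
Lemma truncated_risk_le m n (A : 'M[R]_(m, n)) (s C : R) : (0 < n)%N -> 0 < s -> 0 <= C ->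
  (forall x : 'cV[R]_n, (forall i, `|(A *m x) i 0| <= 1) -> \sum_j x j 0 ^+ 2 <= C) ->
  exists (U : 'M[R]_n) (k : 'rV[R]_n), [/\ feasible A U k,
    forall j, k 0 j <= s ^+ 2, 0 < \sum_j k 0 j &
    (truncated_risk (body A) s <=
      (40 * \sum_j k 0 j)%:E)%E].
Proof.
move=> n0 s0 C0 AC; have s20 : 0 < s ^+ 2 by rewrite exprn_gt0.
have [U [v [[UU v0 Av] f0 opt]]] := feasible_opt n0 s0 C0 AC.
pose k : 'rV[R]_n := \row_j Num.min (v 0 j) (s ^+ 2).
have kE j : k 0 j = Num.min (v 0 j) (s ^+ 2) by rewrite mxE.
have k0 j : 0 <= k 0 j by rewrite kE le_min v0 ltW.
have kf : s ^+ 2 * shrunk_trace s v <= \sum_j k 0 j.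
  rewrite mulr_sumr; apply: ler_sum => j _; rewrite kE.
  have c0 : 0 < v 0 j + s ^+ 2 by rewrite ltr_wpDl.
  rewrite mulrA ler_pdivrMr//; have := v0 j.
  by case: (leP (v 0 j) (s ^+ 2)); nra.
exists U, k; split.
- split => // i; apply: le_trans (Av i); apply: ler_sum => j _.
  by rewrite ler_wpM2r ?sqr_ge0// kE ge_min lexx.
- by move=> j; rewrite kE ge_min lexx orbT.
- by apply: lt_le_trans kf; rewrite mulr_gt0.
pose I : pred 'I_n := fun j => s ^+ 2 < v 0 j.
have PP := coord_projP I UU.
apply: (@le_trans _ _ (worst_risk (body A) s
   (fun y => coord_proj U I *m y))).
  by apply: ereal_inf_lbound; exists (coord_proj U I).
apply: ge_ereal_sup => _ [x Ax <-].
rewrite (mean_sq_err_proj PP)//; apply: le_trans (leeD2l _ (proj_noise_le PP s0)) _.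
rewrite -EFinD lee_fin tr_coord_proj// coord_proj_err//.
have h1 : s ^+ 2 * \sum_(j | I j) 1 <= \sum_j k 0 j.
  rewrite mulr_sumr [leRHS](bigID I)/= -[leLHS]addr0 lerD ?sumr_ge0//.
  by apply: ler_sum => j Ij; rewrite mulr1 kE le_min lexx (ltW Ij).
have h2 : \sum_(j | ~~ I j) (U^T *m x) j ord0 ^+ 2 <= 24 * \sum_j k 0 j.
  have := opt x Ax; set Z := \sum_j _ / _ => optx.
  apply: (@le_trans _ _ (4 * s ^+ 2 * (s ^+ 2 * Z))); last first.
    apply: (@le_trans _ _ (4 * s ^+ 2 * (6 * shrunk_trace s v))).
      by rewrite ler_wpM2l// mulr_ge0// ltW.
    by move: kf; lra.
  rewrite !mulr_sumr [leRHS](bigID I)/= -[leLHS]add0r; apply: lerD.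
    apply: sumr_ge0 => j _; rewrite mulr_ge0 ?(mulr_ge0 _ (ltW s20))//.
    by rewrite (mulr_ge0 (ltW s20))// divr_ge0 ?sqr_ge0.
  apply: ler_sum => j; rewrite /I -leNgt => vs.
  have c0 : 0 < v 0 j + s ^+ 2 by rewrite ltr_wpDl.
  move: ((U^T *m x) j ord0) => y;
    move: (v 0 j + s ^+ 2) c0 (lerD vs (lexx (s ^+ 2))) => c c0 cs.
  rewrite (_ : 4 * _ * _ = y ^+ 2 * ((2 * s ^+ 2) ^+ 2 / c ^+ 2)); last by ring.
  rewrite ler_peMr ?sqr_ge0// ler_pdivlMr ?exprn_gt0// mul1r.
  by rewrite ler_sqr ?nnegrE//; lra.
by move: h1 h2; lra.
Qed.

(** By [hoeffding_signs], a random vertex of the hypercube violates one row with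
    probability at most 2 exp (- L / 8) = 1 / (4 m), hence some row with
    probability at most 1/4. *)
Lemma minimax_risk_ge m n (A : 'M[R]_(m, n)) (U : 'M[R]_n) (k : 'rV[R]_n) (s : R) :
  (2 <= m)%N -> 0 < s -> feasible A U k -> (forall j, k 0 j <= s ^+ 2) ->
  ((\sum_j k 0 j / (256 * ln m%:R))%:E <= minimax_risk (body A) s)%E.
Proof.
move=> m2 s0 [UU k0 Ak] ks.
have lm0 : 0 < ln m%:R :> R by rewrite ln_gt0// ltr1n.
pose L : R := 8 * ln (8 * m%:R).
have m0 : 0 < m%:R :> R by rewrite ltr0n; lia.
have L8 : L <= 32 * ln m%:R.
  have : ln 8 <= 3 * ln m%:R :> R.
    rewrite (_ : 3 * ln m%:R = ln (m%:R ^+ 3)); last by rewrite lnXn// mulr_natl.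
    by rewrite ler_ln ?posrE ?exprn_gt0// -natrX ler_nat (leq_exp2r 2 m (e := 3)).
  by rewrite /L lnM ?posrE//; lra.
have L1 : 1 <= L.
  have : 1 - 8^-1 <= ln 8 :> R.
    have := @le_ln1Dx R (8^-1 - 1).
    by rewrite addrCA subrr addr0 lnV ?posrE// => /(_ _); lra.
  have : 0 < ln m%:R :> R by [].
  by rewrite /L lnM ?posrE//; lra.
have L0 : 0 < L by apply: lt_le_trans L1.
apply: le_ereal_inf_tmp => _ [M mM <-].
pose r j := Num.sqrt (k 0 j / L).
have r2 j : r j ^+ 2 = k 0 j / L by rewrite sqr_sqrtr// divr_ge0// ltW.
have r01 j : 0 <= r j <= s.
  rewrite sqrtr_ge0/= -ler_sqr ?nnegrE ?sqrtr_ge0 ?(ltW s0)// r2.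
  by apply: le_trans (ks j); rewrite ler_pdivrMr// ler_peMr.
pose G : pred {ffun 'I_n -> bool} := fun b =>
  [forall i, `|(A *m vertex U r b) i ord0| <= 1].
pose B i := [pred b : {ffun 'I_n -> bool} |
  1 < `|\sum_j (-1) ^+ b j * (r j * (A *m U) i j)|].
have AvE b i : (A *m vertex U r b) i ord0 = \sum_j (-1) ^+ b j * (r j * (A *m U) i j).
  rewrite mulmx_sumr summxE; apply: eq_bigr => j _.
  rewrite -scalemxAr mxE mulrA; congr (_ * _).
  by rewrite !mxE; apply: eq_bigr => l _; rewrite !mxE.
have cardB i : #|B i|%:R <= 2 * (2 ^+ n * expR (- (L / 8))) :> R.
  apply: hoeffding_signs => //.
  apply: le_trans (Ak i); rewrite mulr_sumr ler_sum// => j _.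
  by rewrite exprMn r2 mulrA (mulrC L) divfK ?gt_eqF.
have expL : expR (- (L / 8)) = (8 * m%:R)^-1.
  by rewrite /L mulrAC divff// mul1r expRN lnK ?posrE ?mulr_gt0.
have Gbad : (4 * #|[predC G]| <= 2 ^ n)%N.
  have : (#|[predC G]| <= \sum_i #|B i|)%N.
    rewrite -sum1_card; under [leqRHS]eq_bigr do rewrite -sum1_card.
    rewrite (exchange_big_dep predT)//= big_mkcond/=; apply: leq_sum => b _.
    case: ifPn => // /fintype.forallPn[i0]; rewrite -ltNge AvE => bi.
    by rewrite (bigD1 i0)//= leq_addr.
  rewrite -(ler_nat R) -[(_ <= 2 ^ n)%N](ler_nat R) natrM natrX natr_sum => h.
  have : \sum_i #|B i|%:R <= \sum_(i < m) 2 * (2 ^+ n * (8 * m%:R)^-1) :> R.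
    by rewrite -expL; apply: ler_sum => i _; exact: cardB.
  rewrite sumr_const card_ord -[X in _ <= X -> _]mulr_natl => /(le_trans h).
  have -> : m%:R * (2 * (2 ^+ n / (8 * m%:R))) = 2 ^+ n / 4 :> R.
    by field; rewrite gt_eqF.
  by lra.
have GX b : G b -> body A (vertex U r b) by move/forallP.
apply: le_trans (assouad UU s0 r01 mM GX Gbad).
rewrite lee_fin; apply: ler_sum => j _; rewrite r2 -mulrA -invfM ler_wpM2l//.
rewrite lef_pV2 ?posrE ?(mulr_gt0 L0) ?(mulr_gt0 _ lm0)//.
by move: L8; lra.
Qed.

Lemma div_ereal_le (T r : \bar R) (K a b : R) : 0 < K -> 0 < a -> 0 < b ->
  (T <= (a * K)%:E -> (K / b)%:E <= r -> T / r <= (a * b)%:E)%E.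
Proof.
move=> K0 a0 b0 Ta; have ab0 : 0 <= a * b by rewrite mulr_ge0// ltW.
case: r => [r| |]; last 2 first.
- by rewrite invey mule0 lee_fin.
- by rewrite leeNy_eq.
rewrite lee_fin => rK.
have r0 : 0 < r by apply: lt_le_trans rK; rewrite divr_gt0.
rewrite inver gt_eqF// lee_pdivrMr//; apply: le_trans Ta _.
rewrite -EFinM lee_fin -mulrA ler_pM2l//.
by move: rK; rewrite ler_pdivrMr// mulrC.
Qed.

Lemma risk_ratio_le m n (A : 'M[R]_(m, n)) (s C : R) : (2 <= m)%N -> (0 < n)%N ->
  0 < s -> 0 <= C -> (forall x : 'cV[R]_n, body A x -> \sum_j x j 0 ^+ 2 <= C) ->
  (truncated_risk (body A) s / minimax_risk (body A) s <= (40 * (256 * ln m%:R))%:E)%E.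
Proof.
move=> m2 n0 s0 C0 AC.
have [U [k [fU ks k0 RT]]] := truncated_risk_le n0 s0 C0 AC.
have := minimax_risk_ge m2 s0 fU ks; rewrite -mulr_suml.
apply: div_ereal_le RT => //.
by rewrite (@mulr_gt0 _ 256)// ln_gt0// ltr1n.
Qed.

Lemma beta_polytope_le m n (X : set 'cV[R]_n) : (2 <= m)%N -> (0 < n)%N ->
  @bounded_polytopes R m n X -> (beta X <= (40 * (256 * ln m%:R))%:E)%E.
Proof.
move=> m2 n0 [bX [A XE]]; rewrite bodyE in XE.
have [C [C0 AC]] : exists C : R, 0 <= C /\ forall x : 'cV[R]_n, body A x ->
    \sum_j x j 0 ^+ 2 <= C.
  have [M [Mreal XM]] := bX.
  pose N := Num.max M 0 + 1.
  have N0 : 0 <= N by rewrite addr_ge0// le_max lexx orbT.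
  have MN : M < N by rewrite ltr_pwDr// le_max lexx.
  exists (n%:R * N ^+ 2); split; first by rewrite mulr_ge0 ?sqr_ge0.
  move=> x Ax; have : `|x| <= N by apply: XM => //; rewrite XE.
  move/(mx_norm_leP _ N0) => xN.
  rewrite mulr_natl -[X in _ *+ X](card_ord n) -sumr_const; apply: ler_sum => j _.
  by rewrite -[leLHS]real_normK ?num_real// ler_sqr ?nnegrE.
by apply: ge_ereal_sup => _ [s s0 <-]; rewrite XE; exact: risk_ratio_le AC.
Qed.

End upper_bound.

(** * Soft thresholding *)

Section soft_threshold.
Context (R : realType).
Local Notation RM := (measurableTypeR R).

(** Soft thresholding at l maps t to t - clip l t. *)
Definition clip (l t : R) : R := Num.max (- l) (Num.min l t).

(** When the noise is below the threshold, soft thresholding never overshoots: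
    the estimate lies between 0 and x, and within 2 l of x. *)
Lemma soft_err_small (l x w : R) : `|w| <= l -> (w - clip l (x + w)) ^+ 2 <= 2 * l * `|x|.
Proof.
rewrite ler_norml => /andP[lw wl]; have xx := ler_norm x; have xN := ler_norm (- x).
rewrite normrN in xN; rewrite /clip.
have x0 := normr_ge0 x.
case: (leP l (x + w)) => h1.
  by rewrite max_r ?lerNl; nra.
case: (leP (- l) (x + w)) => h2; last by nra.
have -> : w - (x + w) = - x by ring.
rewrite sqrrN -real_normK ?num_real// expr2 ler_wpM2r//.
by case: (ger0P x) => _; lra.
Qed.

Lemma soft_err_large (l x w : R) : 0 <= l <= `|w| ->
    (w - clip l (x + w)) ^+ 2 <= 4 * w ^+ 2.
Proof.
move=> /andP[l0 lw]; have cl : `|clip l (x + w)| <= l.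
  by rewrite ler_norml /clip le_max lexx/= ge_max ge_min lexx/= andbT; lra.
have : `|w - clip l (x + w)| <= 2 * `|w|.
  by apply: (le_trans (ler_normB _ _)); lra.
rewrite -ler_sqr ?nnegrE ?mulr_ge0// real_normK ?num_real// exprMn real_normK ?num_real//.
by rewrite -natrX.
Qed.

(** On |t| >= tau the linear function tau |t| - tau^2 + tau is at least |t|, so
    an exponential of |t| can be traded for one with the smaller Gaussian tail. *)
Lemma sqr_tail_le (tau t : R) : 1 <= tau -> tau <= `|t| ->
  t ^+ 2 <= 4 * expR (tau - tau ^+ 2) * (expR (tau * t) + expR (- tau * t)).
Proof.
move=> tau1 tt; have t0 := normr_ge0 t.
have h1 : t ^+ 2 <= 4 * expR `|t|.
  rewrite -real_normK ?num_real//.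
  have -> : `|t| = `|t| / 2 + `|t| / 2 by lra.
  by rewrite expRD; have := expR_ge1Dx (`|t| / 2); nra.
have h2 : expR `|t| <= expR (tau - tau ^+ 2) * expR (tau * `|t|).
  by rewrite -expRD ler_expR; nra.
have h3 : expR (tau * `|t|) <= expR (tau * t) + expR (- tau * t).
  case: (ger0P t) => _; first by rewrite lerDl expR_ge0.
  by rewrite mulrN -mulNr lerDr expR_ge0.
have := expR_ge0 (tau - tau ^+ 2); nra.
Qed.

Lemma soft_err_le (s tau x w : R) : 0 < s -> 1 <= tau ->
  (w - clip (s * tau) (x + w)) ^+ 2 <= 2 * (s * tau) * `|x| +
  16 * s ^+ 2 * expR (tau - tau ^+ 2) * (expR (tau / s * w) + expR (- (tau / s) * w)).
Proof.
move=> s0 tau1; have st0 : 0 <= s * tau by rewrite mulr_ge0 ?(ltW s0)//; lra.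
case: (leP `|w| (s * tau)) => h.
  apply: le_trans (soft_err_small _ h) _; rewrite lerDl.
  rewrite mulr_ge0 ?addr_ge0 ?expR_ge0// mulr_ge0 ?expR_ge0//.
  by rewrite mulr_ge0 ?sqr_ge0.
apply: le_trans (soft_err_large _ _) _; first by rewrite st0 ltW.
have := @sqr_tail_le tau (w / s) tau1.
rewrite normrM normfV (gtr0_norm s0) ler_pdivlMr// mulrC (ltW h) => /(_ isT).
rewrite exprMn exprVn ler_pdivrMr ?exprn_gt0// => h'.
have -> : tau / s * w = tau * (w / s) by ring.
have -> : - (tau / s) * w = - tau * (w / s) by ring.
have : 0 <= 2 * (s * tau) * `|x| by rewrite mulr_ge0// mulr_ge0.
by move: h'; lra.
Qed.

Lemma measurable_clip l : measurable_fun setT (clip l : RM -> RM).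
Proof.
by apply: measurable_maxr => //; apply: measurable_minr.
Qed.

Lemma dotv_delta n (i : 'I_n) (y : 'cV[R]_n) : dotv (delta_mx i ord0) y = y i ord0.
Proof.
rewrite /dotv (bigD1 i)//= big1 => [|j ji].
  by rewrite mxE !eqxx mul1r addr0.
by rewrite mxE (negbTE ji) mul0r.
Qed.

Definition soft_estimator n k (l : R) (y : 'cV[R]_n) : 'cV[R]_n :=
  \col_j if (j < k)%N then y j ord0 - clip l (y j ord0) else 0.

Lemma measurable_soft_estimator n k l :
  measurable_fun setT (@soft_estimator n k l).
Proof.
apply: measurable_fun_cV => j; pose c (y : 'cV[R]_n) : RM := y j ord0.
have mc : measurable_fun setT c by exact: measurable_coord.
rewrite (_ : (fun y => _) = if (j < k)%N then (fun y => c y - clip l (c y)) else cst 0).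
  case: (j < k)%N; last exact: measurable_cst.
  by apply: measurable_funB => //; exact: (measurableT_comp (measurable_clip l)).
by apply/funext => y; rewrite mxE; case: (j < k)%N.
Qed.

(** The bias is paid in the l1 norm on the first k coordinates and in the l2 norm
    on the rest, which is estimated by 0; the last term is the contribution of
    large noise. *)
Lemma soft_estimator_risk n k (s tau : R) (x : 'cV[R]_n) : 0 < s -> 1 <= tau ->
  (mean_sq_err s (soft_estimator k (s * tau)) x <=
   (2 * (s * tau) * (\sum_(j < n | (j < k)%N) `|x j ord0|) +
    \sum_(j < n | ~~ (j < k)%N) x j ord0 ^+ 2 +
    (\sum_(j < n | (j < k)%N) 1) * (32 * s ^+ 2 * expR (tau - tau ^+ 2 / 2)))%:E)%E.
Proof.
move=> s0 tau1; rewrite mean_sq_errE.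
pose e (a : R) (j : 'I_n) w := expR (dotv (a *: delta_mx j ord0) w).
have dotd (a : R) (j : 'I_n) w : dotv (a *: delta_mx j ord0) w = a * w j ord0.
  by rewrite dotvZl dotv_delta.
pose c := 16 * s ^+ 2 * expR (tau - tau ^+ 2).
have c0 : 0 <= c by rewrite mulr_ge0 ?expR_ge0// mulr_ge0 ?sqr_ge0.
pose D := 2 * (s * tau) * (\sum_(j < n | (j < k)%N) `|x j ord0|) +
    \sum_(j < n | ~~ (j < k)%N) x j ord0 ^+ 2.
have st0 : 0 <= s * tau by rewrite mulr_ge0 ?(ltW s0)//; lra.
have D0 : 0 <= D.
  rewrite addr_ge0//; last by apply: sumr_ge0 => j _; rewrite sqr_ge0.
  by rewrite mulr_ge0 ?sumr_ge0// mulr_ge0.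
pose f j w := c * (e (tau / s) j w + e (- (tau / s)) j w).
have me a j : measurable_fun setT (e a j : _ -> RM) by exact: measurable_expdot.
have mf j : measurable_fun setT (f j : _ -> RM).
  by apply: measurable_funM => //; apply: measurable_funD; exact: me.
have f0 j w : 0 <= f j w by rewrite mulr_ge0// addr_ge0// expR_ge0.
have Ef j : Egauss s (f j) = (32 * s ^+ 2 * expR (tau - tau ^+ 2 / 2))%:E.
  rewrite EgaussZ//; first last.
  - by move=> w; rewrite addr_ge0 ?expR_ge0.
  - by apply: measurable_funD; exact: me.
  rewrite EgaussD//; try (by move=> w; exact: expR_ge0); try exact: me.
  have dd a : dotv (a *: delta_mx j ord0) (a *: delta_mx j ord0) = a ^+ 2 :> R.
    by rewrite dotd !mxE !eqxx mulr1 expr2.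
  rewrite !Egauss_exp// !dd sqrrN -EFinD -EFinM; congr EFin.
  have -> : s ^+ 2 * (tau / s) ^+ 2 / 2 = tau ^+ 2 / 2 by field; rewrite gt_eqF.
  have -> : tau - tau ^+ 2 / 2 = (tau - tau ^+ 2) + tau ^+ 2 / 2 by lra.
  by rewrite expRD /c; ring.
pose F w := \sum_(j < n) (if (j < k)%N then f j w else 0).
have mif (j : 'I_n) : measurable_fun setT ((fun w => if
    (j < k)%N then f j w else 0) : _ -> RM).
  by case: (j < k)%N.
have if0 (j : 'I_n) w : 0 <= (if (j < k)%N then f j w else 0) by case: ifP.
apply: (@le_trans _ _ (Egauss s (fun w => D + F w))).
  apply: Egauss_le.
  - have mu (j : 'I_n) : measurable_fun setT (fun w =>
        (x - soft_estimator k (s * tau) (x + w)) j ord0 : RM).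
      under eq_fun do rewrite mxE [X in _ + X]mxE.
      apply: measurable_funB => //; apply: (measurableT_comp (measurable_coord j)).
      exact: (measurableT_comp (measurable_soft_estimator _ _) (measurable_addvl x)).
    by apply: measurable_sum => j; apply: measurable_funM; exact: mu.
  - by apply: measurable_funD => //; exact: measurable_sum.
  - by move=> w; exact: dotv_ge0.
  move=> w; rewrite /dotv (bigID (fun j : 'I_n => (j < k)%N))/=.
  rewrite /F -big_mkcond/= /D mulr_sumr addrAC -big_split/=.
  apply: lerD; apply: ler_sum => j jk.
    have -> : (x - soft_estimator k (s * tau) (x + w)) j ord0 =
        - (w j ord0 - clip (s * tau) (x j ord0 + w j ord0)).
      by rewrite !mxE jk; ring.
    rewrite mulrNN -expr2; apply: le_trans (soft_err_le _ _ s0 tau1) _.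
    by rewrite /f /e !dotd.
  by rewrite !mxE (negbTE jk) subr0 expr2.
rewrite EgaussD//; last 2 first.
- exact: measurable_sum.
- by move=> w; exact: sumr_ge0.
rewrite Egauss_cst Egauss_sum// -/D [leRHS]EFinD leeD2l// mulr_suml
    -sumEFin big_mkcond [leRHS]big_mkcond/=.
apply: lee_sum => j _; case: ifP => _; last by rewrite Egauss_cst.
by rewrite Ef mul1r.
Qed.

End soft_threshold.

(** * The cross-polytope *)

Section cross_polytope.
Context (R : realType).

(** Fewer than m constraints are padded with zero rows. *)
Lemma body_of_rows (I : finType) n m (a : I -> 'rV[R]_n) : (#|I| <= m)%N ->
  exists A : 'M[R]_(m, n),
    body A = [set x | forall i, `|(a i *m x) ord0 ord0| <= 1].
Proof.
move=> Im; pose A : 'M[R]_(m, n) := \matrix_(r < m)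
  (if insub (r : nat) is Some k then a (enum_val (k : 'I_#|I|)) else 0).
have AE x r : (A *m x) r ord0 = ((row r A) *m x : 'cV[R]_1) ord0 ord0.
  by rewrite -row_mul [RHS]mxE.
exists A; apply/seteqP; split => x /= h i.
  have lt : (enum_rank i < m)%N by apply: leq_trans Im; exact: ltn_ord.
  by have := h (Ordinal lt); rewrite AE rowK/= valK enum_rankK.
rewrite AE rowK; case: insubP => [u _ _|_]; first exact: h.
by rewrite mul0mx mxE normr0.
Qed.

Section cross.
Context (n k : nat) (kn : (k <= n)%N) (d : R) (d01 : 0 < d <= 1).
Local Notation wd := (widen_ord kn).

(** The 2^k sign vectors cut out the unit ball of the l1 norm in the first k
    coordinates; the box has half side 1 in these coordinates, so that its rows are
    indexed uniformly, and half side d in the others. *)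
Definition cross_row (i : {ffun 'I_k -> bool} + 'I_n) : 'rV[R]_n :=
  match i with
  | inl f => \sum_j (-1) ^+ f j *: delta_mx ord0 (wd j)
  | inr j => (if (j < k)%N then 1 else d^-1) *: delta_mx ord0 j
  end.

Definition cross : set 'cV[R]_n :=
  [set x | forall i, `|(cross_row i *m x) ord0 ord0| <= 1].

Lemma delta_mulmx j (x : 'cV[R]_n) : (delta_mx ord0 j *m x) (ord0 : 'I_1) ord0 = x j ord0.
Proof. by rewrite -rowE mxE. Qed.

Lemma cross_rowE i (x : 'cV[R]_n) : (cross_row i *m x) ord0 ord0 =
  match i with
  | inl f => \sum_j (-1) ^+ f j * x (wd j) ord0
  | inr j => (if (j < k)%N then 1 else d^-1) * x j ord0
  end.
Proof.
case: i => [f|j] /=; last by rewrite -scalemxAl mxE delta_mulmx.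
rewrite mulmx_suml summxE; apply: eq_bigr => j _.
by rewrite -scalemxAl mxE delta_mulmx.
Qed.

(** The active constraint is the one with the signs of x. *)
Lemma cross_l1 x : cross x -> \sum_(j < n | (j < k)%N) `|x j ord0| <= 1.
Proof.
move=> cx; have := cx (inl [ffun j => x (wd j) ord0 < 0]); rewrite cross_rowE.
rewrite (big_ord_narrow kn); apply: le_trans; apply: le_trans (ler_norm _).
apply: ler_sum => j _; rewrite ffunE.
case: (ltrP (x (wd j) ord0) 0) => h.
  by rewrite expr1 mulN1r ltr0_norm.
by rewrite expr0 mul1r ger0_norm.
Qed.

Lemma cross_box x (j : 'I_n) : cross x -> ~~ (j < k)%N -> `|x j ord0| <= d.
Proof.
case/andP: d01 => d0 _.
move=> cx /negbTE jk; have := cx (inr j); rewrite cross_rowE jk.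
by rewrite normrM gtr0_norm ?invr_gt0// ler_pdivrMl// mulr1.
Qed.

Lemma cross_le1 x j : cross x -> `|x j ord0| <= 1.
Proof.
case/andP: d01 => d0 d1; move=> cx; case: (boolP (j < k)%N) => jk.
  by have := cx (inr j); rewrite cross_rowE jk mul1r.
exact: le_trans (cross_box cx jk) d1.
Qed.

Lemma cross_delta (i : 'I_n) : (i < k)%N -> cross (delta_mx i ord0).
Proof.
move=> ik [f|j]; rewrite cross_rowE.
  rewrite (bigD1 (Ordinal ik))//= big1 => [|j ji].
    rewrite addr0 mxE (_ : wd _
        = i) ?eqxx ?mulr1 ?normrM ?normr1 ?normrX ?normrN1 ?expr1n//.
    exact: val_inj.
  rewrite mxE (_ : _ == _ = false) ?mulr0//; apply: contraNF ji => /eqP ji.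
  by apply/eqP/val_inj; rewrite /= -ji.
rewrite mxE; case: eqP => [->|_]; last by rewrite mulr0 normr0.
by rewrite ik mul1r eqxx normr1.
Qed.

Lemma cross_polytope m : (2 ^ k + n <= m)%N -> @bounded_polytopes R m n cross.
Proof.
move=> km; split.
  exists 1; split; first exact: num_real.
  move=> N N1 x cx; apply/mx_norm_leP => [|i j]; first by rewrite ltW// (lt_trans _ N1).
  by rewrite ord1; apply: le_trans (cross_le1 i cx) (ltW N1).
have [|A AE] := @body_of_rows _ n m cross_row.
  by rewrite card_sum card_ffun card_bool !card_ord.
by exists A; rewrite bodyE AE.
Qed.

Context (k0 : (0 < k)%N).

(** Average the risks at the first k basis vectors.  With t the sum of the first
    k diagonal entries of P, the average bias is 1 - t / k, and the noise is at
    least t / (4 k). *)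
Lemma cross_truncated_risk (s : R) : 0 < s -> s ^+ 2 * k%:R = 1 ->
  ((4^-1)%:E <= truncated_risk cross s)%E.
Proof.
move=> s0 sk; apply: le_ereal_inf_tmp => _ [P PP <-].
have [idP symP] := PP.
have Pii i : P i i = dotv (col i P) (col i P).
  rewrite -{1}idP -{1}symP mxE.
  by apply: eq_bigr => j _; rewrite !mxE.
set W := worst_risk _ _ _.
have mW (i : 'I_n) : (i < k)%N -> ((1 - P i i + s ^+ 2 * \tr P / 4)%:E <= W)%E.
  move=> ik; apply: (@le_trans _ _ (mean_sq_err s (fun y => P *m y) (delta_mx i ord0))).
    rewrite (mean_sq_err_proj PP) EFinD; apply: leeD; last exact: proj_noise_ge.
    rewrite lee_fin dotvBl !(dotvDr, dotvNr) ![dotv (P *m _) (P *m _)]dotv_trmx.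
    rewrite symP mulmxA idP subrr subr0 [dotv _ (P *m _)]dotvC -[X in _ <= _ - X]dotvC.
    by rewrite !dotv_delta -colE !mxE !eqxx.
  by apply: ereal_sup_ubound; exists (delta_mx i ord0) => //; exact: cross_delta.
have mW' (j : 'I_k) := mW (wd j) (ltn_ord j).
have P01 i : 0 <= P i i <= 1.
  have := Pii i; rewrite /dotv (bigD1 i)//= !mxE.
  set S := \sum_(_ | _) _ => PS.
  have S0 : 0 <= S by apply: sumr_ge0 => j _; rewrite -expr2 sqr_ge0.
  apply/andP; split; first by rewrite Pii dotv_ge0.
  by rewrite leNgt; apply/negP => P1; nra.
pose t := \sum_(j < k) P (wd j) (wd j).
have tk : t <= k%:R.
  rewrite -[X in _ <= X%:R](card_ord k) -sumr_const; apply: ler_sum => j _.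
  by case/andP: (P01 (wd j)).
have ttr : t <= \tr P.
  rewrite /t /mxtrace [leRHS](bigID (fun j : 'I_n => (j < k)%N))/= (big_ord_narrow kn).
  by rewrite lerDl sumr_ge0// => j _; case/andP: (P01 j).
case: W mW' {mW} => [x mW'| |/(_ (Ordinal k0))//]; last by rewrite leey.
have : \sum_(j < k) (1 - P (wd j) (wd j) + s ^+ 2 * \tr P / 4) <= \sum_(j < k) x.
  by apply: ler_sum => j _; rewrite -lee_fin.
have S1 (a : R) : \sum_(j < k) a = a * k%:R by rewrite sumr_const card_ord mulr_natr.
rewrite big_split sumrB/= !S1 -/t mul1r => h.
have kR : 0 < k%:R :> R by rewrite ltr0n.
have : s ^+ 2 * \tr P / 4 * k%:R = s ^+ 2 * k%:R * (\tr P / 4) by ring.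
by rewrite sk mul1r lee_fin -(ler_pM2r kR) => E; move: h; rewrite E; lra.
Qed.

Lemma cross_minimax_risk (s tau : R) : 0 < s -> 1 <= tau -> 
  (0 <= minimax_risk cross s <= (2 * (s * tau) + n%:R * d ^+ 2 +
     k%:R * (32 * s ^+ 2 * expR (tau - tau ^+ 2 / 2)))%:E)%E.
Proof.
move=> s0 tau1; apply/andP; split.
  apply: le_ereal_inf_tmp => _ [M mM <-].
  apply: (@le_trans _ _ (mean_sq_err s M (delta_mx (wd (Ordinal k0)) ord0))).
    by rewrite mean_sq_errE; apply: Egauss_ge0 => w; exact: dotv_ge0.
  by apply: ereal_sup_ubound; exists (delta_mx (wd (Ordinal k0)) ord0) => //;
    exact: cross_delta.
have st0 : 0 <= s * tau by rewrite mulr_ge0 ?(ltW s0)//; lra.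
apply: (@le_trans _ _ (worst_risk cross s (soft_estimator k (s * tau)))).
  by apply: ereal_inf_lbound; exists (soft_estimator k (s * tau)) => //;
    exact: measurable_soft_estimator.
apply: ge_ereal_sup => _ [x cx <-].
apply: le_trans (soft_estimator_risk k x s0 tau1) _; rewrite lee_fin.
have h1 := ler_wpM2l (mulr_ge0 (ler0n R 2) st0) (cross_l1 cx).
have h2 : \sum_(j < n | ~~ (j < k)%N) x j ord0 ^+ 2 <= n%:R * d ^+ 2.
  rewrite mulr_natl -[X in _ *+ X](card_ord n) -sumr_const big_mkcond.
  apply: ler_sum => j _; case: ifPn => jk; last exact: sqr_ge0.
  rewrite -[leLHS]real_normK ?num_real// ler_sqr ?nnegrE//; first exact: cross_box.
  by case/andP: d01 => /ltW.
have -> : \sum_(j < n | (j < k)%N) 1 = k%:R :> R.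
  by rewrite (big_ord_narrow kn) sumr_const card_ord.
by rewrite lerD2r lerD//; move: h1; rewrite mulr1.
Qed.

End cross.
End cross_polytope.

(** * Lower bound on the ratio of the risks *)

Section numerics.
Context (R : realType).

Lemma div_ereal_ge (T r : \bar R) (a b : R) : 0 < a -> 0 < b ->
  (a%:E <= T -> 0 <= r -> r <= b%:E -> (a / b)%:E <= T / r)%E.
Proof.
move=> a0 b0 aT; case: r => [r| |]; last 2 first.
- by rewrite leye_eq.
- by rewrite leeNy_eq.
rewrite !lee_fin => r0 rb; rewrite inver; case: eqP => [_|/eqP rn0].
  by rewrite gt0_muley ?leey//; apply: lt_le_trans aT; rewrite lte_fin.
have rp : 0 < r by rewrite lt_neqAle eq_sym rn0.
rewrite lee_pdivlMr//; apply: le_trans aT; rewrite -EFinM lee_fin.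
by rewrite mulrAC ler_pdivrMr// ler_pM2l.
Qed.

(** With s = k^-1/2 and tau^2 = 2 log k, the large noise term of
    [cross_minimax_risk] is at most 32 s, because tau - tau^2 / 2 <= - tau^2 / 4
    as soon as tau >= 4. *)
Lemma beta_cross_ge n k (kn : (k <= n)%N) : (0 < n)%N -> 8 <= ln (k%:R : R) ->
  ((Num.sqrt (k%:R / ln k%:R) / 148)%:E <= beta (cross kn (n%:R^-1 : R)))%E.
Proof.
move=> n0 k8.
have kgt1 : 1 < k%:R :> R.
  by rewrite ltNge; apply/negP => k1; have := ln_le0 k1; lra.
have kR : 0 < k%:R :> R by lra.
have k0 : (0 < k)%N by rewrite -(ltr0n R).
have nR : 0 < n%:R :> R by rewrite ltr0n.
set l : R := ln k%:R in k8 *.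
have l0 : 0 < l by lra.
pose q := Num.sqrt (k%:R : R); pose sl := Num.sqrt l.
have q0 : 0 < q by rewrite sqrtr_gt0.
have sl0 : 0 < sl by rewrite sqrtr_gt0.
have q2 : q ^+ 2 = k%:R by rewrite sqr_sqrtr// ltW.
have sl2 : sl ^+ 2 = l by rewrite sqr_sqrtr// ltW.
have sl1 : 1 <= sl by rewrite -ler_sqr ?nnegrE ?(ltW sl0)// expr1n sl2; lra.
pose s := q^-1; pose tau := Num.sqrt (2 * l).
have s0 : 0 < s by rewrite invr_gt0.
have tau2 : tau ^+ 2 = 2 * l by rewrite sqr_sqrtr// mulr_ge0// ltW.
have tau4 : 4 <= tau.
  by rewrite -ler_sqr ?nnegrE ?sqrtr_ge0// tau2; lra.
have tausl : tau <= 2 * sl.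
  rewrite -ler_sqr ?nnegrE ?sqrtr_ge0 ?mulr_ge0 ?(ltW sl0)// tau2 exprMn sl2; lra.
have d01 : 0 < (n%:R^-1 : R) <= 1.
  by rewrite invr_gt0 nR/= invf_le1// ler1n.
have sk : s ^+ 2 * k%:R = 1 by rewrite exprVn q2 mulVf// gt_eqF.
have RT := cross_truncated_risk kn (n%:R^-1 : R) k0 s0 sk.
have tau1 : 1 <= tau by lra.
have /andP[R0 RM] := cross_minimax_risk kn d01 k0 s0 tau1.
apply: (@le_trans _ _ (truncated_risk (cross kn (n%:R^-1
    : R)) s / minimax_risk (cross kn (n%:R^-1 : R)) s)%E); last first.
  by apply: ereal_sup_ubound; exists s.
have RM' : (minimax_risk (cross kn (n%:R^-1 : R)) s <= (37 * (sl / q))%:E)%E.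
  apply: le_trans RM _; rewrite lee_fin.
  have e1 : expR (tau - tau ^+ 2 / 2) <= s.
    have -> : s = expR (- (l / 2)).
      rewrite expRN /s; congr (_^-1).
      rewrite /q -{1}(lnK kR) -/l (_ : expR l = expR (l / 2) ^+ 2).
        by rewrite sqrtr_sqr ger0_norm ?expR_ge0.
      by rewrite expr2 -expRD; congr expR; lra.
    by rewrite ler_expR; nra.
  have e2 : n%:R * (n%:R^-1) ^+ 2 <= s.
    rewrite expr2 mulrA divff ?gt_eqF// mul1r /s lef_pV2 ?posrE//.
    have kn' : k%:R <= n%:R :> R by rewrite ler_nat.
    have n1 : 1 <= n%:R :> R by rewrite ler1n.
    by rewrite -ler_sqr ?nnegrE ?(ltW q0)// q2; nra.
  have -> : k%:R * (32 * s ^+ 2 * expR (tau - tau ^+ 2 / 2))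
      = 32 * expR (tau - tau ^+ 2 / 2).
    rewrite (_ : _ * (_ * _) = s ^+ 2 * k%:R * (32 * expR (tau - tau ^+ 2 / 2))).
      by rewrite sk mul1r.
    by ring.
  have e3 : 2 * (s * tau) <= 4 * (sl / q).
    by rewrite mulrC -/s; nra.
  have e4 : s <= sl / q by rewrite -[leLHS]mul1r ler_wpM2r// ltW.
  by lra.
have sq0 : 0 < 37 * (sl / q) by rewrite mulr_gt0// divr_gt0.
apply: le_trans (div_ereal_ge _ sq0 RT R0 RM'); last by rewrite invr_gt0.
rewrite lee_fin sqrtrM ?ler0n// sqrtrV ?(ltW l0)// -/q -/sl.
rewrite (_ : _ / (37 * _) = q / sl / 148)//.
by field; rewrite !gt_eqF.
Qed.

Lemma exprn2_le_powR (k m : nat) (d : R) : (0 < m)%N -> k%:R <= d * ln m%:R ->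
  2 ^+ k <= (m%:R : R) `^ d.
Proof.
move=> m0 kd; rewrite /powR pnatr_eq0 -[m == 0%N]negbK -lt0n m0/=.
apply: (@le_trans _ _ (expR k%:R)); last by rewrite ler_expR.
rewrite -[k%:R]mul1r expRM_natr.
by apply: lerXn2r; rewrite ?nnegrE ?expR_ge0//; have := expR_ge1Dx (1 : R); lra.
Qed.

(** The dimension k = c log m of the cross-polytope must satisfy k <= n, which
    follows from c <= a, and 2^k <= m^d, which follows from c <= d. *)
Lemma beta_infty_ge (a d : R) : 0 < a -> 0 < d ->
  exists b : R, 0 < b /\
  exists m0 : nat, forall m n : nat, (m0 <= m)%N ->
    a * ln m%:R <= n%:R -> n%:R + m%:R `^ d <= m%:R ->
    ((b * Num.sqrt (ln m%:R / ln (ln m%:R)))%:E <= beta_infty R m n)%E.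
Proof.
move=> a0 d0; pose c := Num.min a (Num.min d 1).
have c0 : 0 < c by rewrite !lt_min a0 d0 ltr01.
have ca : c <= a by rewrite ge_min lexx.
have cd : c <= d by rewrite !ge_min lexx !orbT.
have c1 : c <= 1 by rewrite !ge_min lexx !orbT.
exists (Num.sqrt (c / 2) / 148); split; first by rewrite divr_gt0// sqrtr_gt0 divr_gt0.
pose T := (expR 8 + 1) / c.
(* Beyond this m, c log m >= exp 8 + 1, hence log k >= 8. *)
exists (Num.truncn (expR T)).+1 => m n mm an nm.
have mT : expR T < m%:R by rewrite -truncn_lt_nat ?expR_ge0.
have mR : 0 < m%:R :> R by apply: le_lt_trans mT; exact: expR_ge0.
pose L := ln (m%:R : R); rewrite -/L in an *.
have LT : T < L by rewrite -ltr_expR /L lnK.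
have cL : expR 8 + 1 <= c * L by rewrite mulrC -ler_pdivrMr// ltW.
have e8 : 9 <= expR 8 :> R by have := expR_ge1Dx (8 : R); lra.
have L0 : 0 < L by rewrite -(pmulr_rgt0 _ c0); lra.
pose k := Num.truncn (c * L).
have /andP[kl ku] : k%:R <= c * L < k.+1%:R by apply: truncn_itv; lra.
have {}ku : c * L - 1 < k%:R by rewrite ltrBlDr natr1.
have kR : 0 < k%:R :> R by lra.
have k8 : 8 <= ln k%:R :> R by rewrite -ler_expR lnK//; lra.
have kn : (k <= n)%N.
  rewrite -(ler_nat R); apply: le_trans kl (le_trans _ an).
  by rewrite ler_pM2r.
have k0 : (0 < k)%N by rewrite -(ltr0n R).
have n0 : (0 < n)%N by apply: leq_trans kn.
have km : (2 ^ k + n <= m)%N.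
  rewrite -(ler_nat R) natrD natrX addrC; apply: le_trans nm; rewrite lerD2l.
  apply: exprn2_le_powR; first by rewrite -(ltr0n R).
  by apply: le_trans kl _; rewrite ler_pM2r.
have n01 : 0 < (n%:R^-1 : R) <= 1.
  by rewrite invr_gt0 ltr0n n0/= invf_le1 ?ltr0n// ler1n.
apply: (@le_trans _ _ (beta (cross kn (n%:R^-1 : R)))); last first.
  by apply: ereal_sup_ubound; exists (cross kn (n%:R^-1 : R)) => //;
    exact: cross_polytope.
apply: le_trans (beta_cross_ge kn n0 k8); rewrite lee_fin.
rewrite mulrAC ler_wpM2r// -sqrtrM ?divr_ge0 ?(ltW c0)//.
have lk : ln k%:R <= ln L.
  by rewrite ler_ln ?posrE//; apply: le_trans kl _; rewrite ler_piMl// ltW.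
apply: ler_wsqrtr.
have lL0 : 0 < ln L by lra.
have h : c / 2 * L <= k%:R by lra.
rewrite mulrA; apply: ler_pM => //.
- by rewrite mulr_ge0 ?divr_ge0// ltW.
- by rewrite invr_ge0 ltW.
- by rewrite lef_pV2 ?posrE//; lra.
Qed.

End numerics.

Local Close Scope classical_set_scope.

(* Bounded polytopes with m constraints exist in R^n only if n <= m; the lower
   bound is stated for n <= m - m^d, with an arbitrarily small exponent d. *)
Theorem theorem3p1 (R : realType) :
  (exists c : R, c < 2 * 10 ^+ 8 /\
    forall a : R, 0 < a ->
    forall m n : nat, (2 <= m)%N -> a * ln m%:R <= n%:R ->
      (beta_infty R m n <= (c * ln m%:R)%:E)%E) /\
  (forall a d : R, 0 < a -> 0 < d ->
    exists b : R, 0 < b /\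
    exists m0 : nat, forall m n : nat, (m0 <= m)%N ->
      a * ln m%:R <= n%:R -> n%:R + m%:R `^ d <= m%:R ->
      ((b * Num.sqrt (ln m%:R / ln (ln m%:R)))%:E <= beta_infty R m n)%E).
Proof.
split; last by move=> a d; exact: beta_infty_ge.
(* The factors come from [truncated_risk_le] and [minimax_risk_ge]. *)
exists (40 * 256); split.
  have : (10 : R) ^+ 4 <= 10 ^+ 8 by rewrite ler_weXn2l// ler1n.
  have -> : (10 : R) ^+ 4 = 100 * 100 by ring.
  lra.
move=> a a0 m n m2 an; apply: ge_ereal_sup => _ [X XP <-].
rewrite -mulrA; apply: beta_polytope_le => //.
by rewrite -(ltr0n R); apply: lt_le_trans an; rewrite mulr_gt0// ln_gt0// ltr1n.
Qed.
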